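(* Let $R$ be a finitely generated associative unital $\mathbb{C}$-algebra. Then the presheaf $$\mathrm{Rep}_R:\ \mathrm{Azufine}_{\mathbb{C}}=(\mathrm{Azumaya}_{\mathbb{C}})^{op}\to\mathrm{Sets},\qquad A\mapsto \mathrm{Alg}_{\mathbb{C}}(R,A)$$ (the set of all $\mathbb{C}$-algebra morphisms from $R$ to $A$) is a sheaf for any Grothendieck topology on $\mathrm{Azufine}_{\mathbb{C}}$ that is coarser than the maximal flat topology.
   Context: An Azumaya algebra $A$ over a commutative ring $C$ is a $C$-algebra that is a faithful finitely generated projective $C$-module such that $A\otimes_C A^{op}\to \mathrm{End}_C(A)$, $a\otimes b\mapsto (r\mapsto arb)$, is an isomorphism; then the center $Z(A)$ is $C$. It is of constant degree $n$ if it has constant rank $n^2$ over $C$. $\mathrm{commalg}_{\mathbb{C}}$ is the category of commutative finitely presented $\mathbb{C}$-algebras. $\mathrm{Azumaya}_{\mathbb{C}}$ is the category whose objects are all Azumaya algebras whose center is in $\mathrm{commalg}_{\mathbb{C}}$ and whose morphisms are the center-preserving $\mathbb{C}$-algebra morphisms $f:A\to A'$, i.e. $f(Z(A))\subseteq Z(A')$. $\mathrm{Azufine}_{\mathbb{C}}$ is its opposite category. Morphisms counted by $\mathrm{Alg}_{\mathbb{C}}(R,A)$ are arbitrary unital $\mathbb{C}$-algebra morphisms. Sieves and Grothendieck topologies on the opposite category are described dually: a sieve on an object $A$ is a collection of morphisms with source $A$ closed under post-composition, and a Grothendieck topology assigns to each $A$ a collection of covering sieves satisfying the usual maximality, stability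 and transitivity axioms. A topology is coarser than another if each of its covering sieves is covering for the other (equality allowed). The flat topology on $\mathrm{commalg}_{\mathbb{C}}$ is generated by the covers $\{C\to C_i\}_{i\in I}$ with $I$ finite and $C\to\prod_{i\in I}C_i$ faithfully flat. The maximal flat topology on $\mathrm{Azumaya}_{\mathbb{C}}$ (equivalently on $\mathrm{Azufine}_{\mathbb{C}}$): let $A$ be an Azumaya algebra with center $C$ and $L$ a sieve on $A$. Let $\pi(L)$ be the set of all morphisms $f:C\to D$ in $\mathrm{commalg}_{\mathbb{C}}$ such that $A\otimes_C D$ is of constant degree and $L$ contains at least one morphism of the form $A\to A\otimes_C D\to B$, where the first map is the canonical one and the second is a $D$-algebra morphism to an Azumaya algebra $B$ with center $D$ and of constant degree. Then $L$ is a covering sieve for the maximal flat topology iff $\pi(L)$ is a covering sieve on $C$ for the flat topology. *)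

(* Defs.v *)
From HB Require Import structures.
From mathcomp Require Import all_boot all_order all_algebra.
From mathcomp Require Import boolp reals complex.
From mathcomp Require Import mpoly.

Set Implicit Arguments.
Unset Strict Implicit.
Unset Printing Implicit Defensive.

Import GRing.Theory.
Local Open Scope ring_scope.
Local Open Scope quotient_scope.

(* The zero ring has to be allowed everywhere: it is an object of the category
   of finitely presented algebras (for instance as a tensor product of two
   members of a flat cover), and it is an Azumaya algebra over itself.
   MathComp's [algType] extends [nzRingType] and excludes it, so an algebra
   over K is a [pzRingType] with a ring morphism from K to its center. *)
Record algebra (K : comPzRingType) := Algebra {
  alg_sort :> pzRingType;
  alg_str : {rmorphism K -> alg_sort};
  alg_strC : forall k a, alg_str k * a = a * alg_str k }.

Definition is_center (A : pzRingType) (z : A) := forall a, z * a = a * z.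

Record alghom (K : comPzRingType) (A B : algebra K) := Alghom {
  alghom_fun :> {rmorphism A -> B};
  alghom_str : forall k, alghom_fun (alg_str A k) = alg_str B k }.

Lemma rmorphism_ext (A B : pzRingType) (f g : {rmorphism A -> B}) :
  f =1 g -> f = g.
Proof.
case: f => f [[Hf1] [Hf2]]; case: g => g [[Hg1] [Hg2]] /= /funext fg.
rewrite /= in fg; subst g.
by rewrite (Prop_irrelevance Hf1 Hg1) (Prop_irrelevance Hf2 Hg2).
Qed.

Lemma alghom_ext (K : comPzRingType) (A B : algebra K) (f g : alghom A B) :
  f =1 g -> f = g.
Proof.
case: f => f Hf; case: g => g Hg /= /rmorphism_ext fg; subst g.
by rewrite (Prop_irrelevance Hf Hg).
Qed.

Section AlghomOps.
Variable K : comPzRingType.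

Definition alghom_id (A : algebra K) : alghom A A.
Proof. by exists (idfun : {rmorphism A -> A}). Defined.

Definition alghom_comp (A B D : algebra K) (g : alghom B D) (f : alghom A B) :
  alghom A D.
Proof.
exists (g \o f : {rmorphism A -> D}) => k.
by rewrite /= alghom_str alghom_str.
Defined.
End AlghomOps.

Definition alg_of_rmorphism (C D : comPzRingType) (f : {rmorphism C -> D}) :
  algebra C := @Algebra C D f (fun c d => mulrC (f c) d).

Definition alg_restrict (K C : comPzRingType) (f : {rmorphism K -> C})
    (A : algebra C) : algebra K :=
  @Algebra K A (alg_str A \o f : {rmorphism K -> A})
    (fun k a => alg_strC (f k) a).

Section AlgOp.
Variables (K : comPzRingType) (A : algebra K).

Definition alg_op_str (k : K) : A^c := alg_str A k.

Fact alg_op_str_additive : additive alg_op_str.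
Proof. by move=> a b; rewrite /alg_op_str rmorphB. Qed.

Fact alg_op_str_multiplicative : monoid_morphism alg_op_str.
Proof.
by split=> [|a b]; rewrite /alg_op_str ?rmorph1 // rmorphM alg_strC.
Qed.

HB.instance Definition _ := GRing.isZmodMorphism.Build K A^c alg_op_str
  alg_op_str_additive.
HB.instance Definition _ := GRing.isMonoidMorphism.Build K A^c alg_op_str
  alg_op_str_multiplicative.

Definition alg_op : algebra K :=
  @Algebra K A^c (alg_op_str : {rmorphism K -> A^c})
    (fun k a => esym (@alg_strC K A k a)).
End AlgOp.

Definition alg_module (K : comPzRingType) (A : algebra K) : Type := A.

Section AlgModule.
Variables (K : comPzRingType) (A : algebra K).

HB.instance Definition _ := GRing.Zmodule.copy (alg_module A) A.

Definition alg_scale (k : K) (a : alg_module A) : alg_module A :=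
  alg_str A k * (a : A).

Fact alg_scaleA a b v : alg_scale a (alg_scale b v) = alg_scale (a * b) v.
Proof. by rewrite /alg_scale rmorphM mulrA. Qed.
Fact alg_scale1 : left_id 1 alg_scale.
Proof. by move=> v; rewrite /alg_scale rmorph1 mul1r. Qed.
Fact alg_scaleDr : right_distributive alg_scale +%R.
Proof. by move=> a u v; rewrite /alg_scale mulrDr. Qed.
Fact alg_scaleDl v : {morph alg_scale^~ v : a b / a + b}.
Proof. by move=> a b; rewrite /alg_scale rmorphD mulrDl. Qed.

HB.instance Definition _ := GRing.Zmodule_isLmodule.Build K (alg_module A)
  alg_scaleA alg_scale1 alg_scaleDr alg_scaleDl.
End AlgModule.

Definition fg_module (C : comPzRingType) (M : lmodType C) :=
  exists (n : nat) (g : 'I_n -> M),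
    forall m, exists c : 'I_n -> C, m = \sum_i c i *: g i.

Definition projective_module (C : comPzRingType) (P : lmodType C) :=
  forall (M N : lmodType C) (g : {linear M -> N}) (f : {linear P -> N}),
    (forall y, exists x, g x = y) ->
    exists h : {linear P -> M}, forall p, g (h p) = f p.

Definition faithful_module (C : comPzRingType) (M : lmodType C) :=
  forall c : C, (forall m : M, c *: m = 0) -> c = 0.

Definition free_of_rank (C : comPzRingType) (M : lmodType C) (r : nat) :=
  exists f : {linear 'rV[C]_r -> M}, bijective f.

(* Finite generation as a (noncommutative) unital algebra: the smallest
   subalgebra containing some finite set is everything. *)
Definition fg_algebra (K : comPzRingType) (A : algebra K) :=
  exists gens : seq A, forall P : A -> Prop,
    (forall k, P (alg_str A k)) ->
    (forall a, a \in gens -> P a) ->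
    (forall a b, P a -> P b -> P (a + b)) ->
    (forall a b, P a -> P b -> P (a * b)) ->
    forall a, P a.

Definition finitely_presented (k : fieldType) (D : comPzRingType)
    (f : {rmorphism k -> D}) :=
  exists (n : nat) (p : {rmorphism {mpoly k[n]} -> D}),
    [/\ forall c : k, p c%:MP = f c,
        forall d, exists q, p q = d
      & exists (m : nat) (g : 'I_m -> {mpoly k[n]}),
          forall q, p q = 0 <->
            exists h : 'I_m -> {mpoly k[n]}, q = \sum_i h i * g i].

Section Tensor.
Variables (C : comPzRingType) (M N : lmodType C).

(* A list of pairs stands for the formal sum of the corresponding pure
   tensors. *)
Inductive tensor_rel : seq (M * N) -> seq (M * N) -> Prop :=
| trel_refl s : tensor_rel s s
| trel_sym s t : tensor_rel s t -> tensor_rel t s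
| trel_trans s t u : tensor_rel s t -> tensor_rel t u -> tensor_rel s u
| trel_cat s s' t t' :
    tensor_rel s s' -> tensor_rel t t' -> tensor_rel (s ++ t) (s' ++ t')
| trel_comm s t : tensor_rel (s ++ t) (t ++ s)
| trel_zero n : tensor_rel [:: (0, n)] [::]
| trel_addl m m' n : tensor_rel [:: (m + m', n)] [:: (m, n); (m', n)]
| trel_addr m n n' : tensor_rel [:: (m, n + n')] [:: (m, n); (m, n')]
| trel_scale c m n : tensor_rel [:: (c *: m, n)] [:: (m, c *: n)].

Definition tensor_relb : rel (seq (M * N)) := fun s t => `[< tensor_rel s t >].

Fact tensor_relb_refl : reflexive tensor_relb.
Proof. by move=> s; apply/asboolP; apply: trel_refl. Qed.
Fact tensor_relb_sym : ssrbool.symmetric tensor_relb.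
Proof. by move=> s t; apply/asboolP/asboolP; apply: trel_sym. Qed.
Fact tensor_relb_trans : transitive tensor_relb.
Proof.
by move=> t s u /asboolP st /asboolP tu; apply/asboolP; apply: trel_trans tu.
Qed.

Canonical tensor_equiv :=
  EquivRel tensor_relb tensor_relb_refl tensor_relb_sym tensor_relb_trans.

Definition tensor := {eq_quot tensor_equiv}.

HB.instance Definition _ := Choice.on tensor.
HB.instance Definition _ := EqQuotient.on tensor.

Definition tsum (s : seq (M * N)) : tensor := \pi_tensor s.
Definition tpure (m : M) (n : N) : tensor := tsum [:: (m, n)].

Lemma tsumP s t : tsum s = tsum t <-> tensor_rel s t.
Proof. by split=> [/eqmodP/asboolP|?]//; apply/eqmodP/asboolP. Qed.

Lemma repr_tsum s : tensor_rel (repr (tsum s)) s.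
Proof. by apply/tsumP; rewrite /tsum reprK. Qed.

Lemma tsum_repr (t : tensor) : tsum (repr t) = t.
Proof. by rewrite /tsum reprK. Qed.

Definition tadd (t u : tensor) := tsum (repr t ++ repr u).
Definition tzero := tsum [::].
Definition topp (t : tensor) := tsum [seq (- p.1, p.2) | p <- repr t].

Lemma tadd_tsum s t : tadd (tsum s) (tsum t) = tsum (s ++ t).
Proof. by apply/tsumP/trel_cat; apply: repr_tsum. Qed.

Fact taddA : associative tadd.
Proof.
move=> t u v; rewrite -(tsum_repr t) -(tsum_repr u) -(tsum_repr v).
by rewrite !tadd_tsum catA.
Qed.

Fact taddC : commutative tadd.
Proof. by move=> t u; apply/tsumP/trel_comm. Qed.

Fact tadd0 : left_id tzero tadd.
Proof. by move=> t; rewrite -(tsum_repr t) /tzero tadd_tsum. Qed.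

Fact taddN : left_inverse tzero topp tadd.
Proof.
move=> t; rewrite -[X in tadd _ X]tsum_repr tadd_tsum; apply/tsumP.
elim: (repr t) => [|[m n] s IHs] /=; first exact: trel_refl.
apply: trel_trans (trel_zero n); rewrite -cat1s.
set N' := map _ _.
apply: (@trel_trans _ ([:: (- m, n)] ++ ([:: (m, n)] ++ (N' ++ s)))).
  apply: trel_cat; first exact: trel_refl.
  rewrite -(cat1s (m, n) s) !catA.
  by apply: trel_cat; [apply: trel_comm|apply: trel_refl].

apply: (@trel_trans _ ([:: (- m, n); (m, n)] ++ [::])).
  by apply: (@trel_cat [:: (- m, n); (m, n)] _ (N' ++ s)) IHs; apply: trel_refl.
by rewrite cats0 -(addNr m); apply: trel_sym; apply: trel_addl.
Qed.

HB.instance Definition _ :=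
  GRing.isZmodule.Build tensor taddA taddC tadd0 taddN.

Lemma tsum_cat s t : tsum (s ++ t) = tsum s + tsum t.
Proof. by rewrite -tadd_tsum. Qed.

Lemma tsumE s : tsum s = \sum_(p <- s) tpure p.1 p.2.
Proof.
elim: s => [|[m n] s IHs]; first by rewrite big_nil.
by rewrite big_cons -IHs -tsum_cat.
Qed.

Lemma tensorE (t : tensor) : t = \sum_(p <- repr t) tpure p.1 p.2.
Proof. by rewrite -tsumE tsum_repr. Qed.

Lemma tensor_ind (P : tensor -> Prop) :
  P 0 -> (forall m n t, P t -> P (tpure m n + t)) -> forall t, P t.
Proof.
move=> P0 PD t; rewrite (tensorE t).
by elim: (repr t) => [|p s IHs]; rewrite ?big_nil // big_cons; apply: PD.
Qed.

Lemma tpureDl m m' n : tpure (m + m') n = tpure m n + tpure m' n.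
Proof. by rewrite -tsum_cat; apply/tsumP/trel_addl. Qed.

Lemma tpureDr m n n' : tpure m (n + n') = tpure m n + tpure m n'.
Proof. by rewrite -tsum_cat; apply/tsumP/trel_addr. Qed.

Lemma tpureZ c m n : tpure (c *: m) n = tpure m (c *: n).
Proof. exact/tsumP/trel_scale. Qed.

Definition balanced (G : zmodType) (f : M -> N -> G) :=
  [/\ forall m m' n, f (m + m') n = f m n + f m' n,
      forall m n n', f m (n + n') = f m n + f m n'
    & forall c m n, f (c *: m) n = f m (c *: n)].

(* The additive map on the tensor product induced by f; it depends on the
   choice of representatives unless f is balanced (see tliftE). *)
Definition tlift (G : zmodType) (f : M -> N -> G) (t : tensor) : G :=
  \sum_(p <- repr t) f p.1 p.2.

Section Lift.
Variables (G : zmodType) (f : M -> N -> G).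
Hypothesis f_bal : balanced f.

Lemma tlift_tsum s : tlift f (tsum s) = \sum_(p <- s) f p.1 p.2.
Proof.
case: f_bal => fDl fDr fZ; rewrite /tlift.
move: (repr (tsum s)) (repr_tsum s) => s' ss'.
elim: s' s / ss' => //.
- by move=> s t u _ -> _ ->.
- by move=> s s' t t' _ IHs _ IHt; rewrite !big_cat IHs IHt.
- by move=> s t; rewrite !big_cat /= addrC.
- move=> n; rewrite big_seq1 big_nil /=; apply: (addrI (f 0 n)).
  by rewrite -fDl !addr0.
- by move=> m m' n; rewrite !big_cons !big_nil /= !addr0 fDl.
- by move=> m n n'; rewrite !big_cons !big_nil /= !addr0 fDr.
- by move=> c m n; rewrite !big_seq1 fZ.
Qed.

Lemma tliftE m n : tlift f (tpure m n) = f m n.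
Proof. by rewrite tlift_tsum big_seq1. Qed.

Lemma tliftD : {morph tlift f : t u / t + u}.
Proof.
move=> t u; rewrite -(tsum_repr t) -(tsum_repr u) -tsum_cat.
by rewrite !tlift_tsum big_cat.
Qed.

Lemma tlift0 : tlift f 0 = 0.
Proof. by rewrite -[0]/(tsum [::]) tlift_tsum big_nil. Qed.
End Lift.
End Tensor.

Definition tmap (C : comPzRingType) (M N M' N' : lmodType C)
    (u : M -> M') (v : N -> N') : tensor M N -> tensor M' N' :=
  tlift (fun m n => tpure (u m) (v n)).

Definition alg_tensor (C : comPzRingType) (A B : algebra C) :=
  tensor (alg_module A) (alg_module B).

Section AlgTensor.
Variables (C : comPzRingType) (A B : algebra C).
Local Notation T := (alg_tensor A B).

HB.instance Definition _ := GRing.Zmodule.on T.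

Definition apure (a : A) (b : B) : T :=
  @tpure C (alg_module A) (alg_module B) a b.

Definition alift (G : zmodType) (f : A -> B -> G) : T -> G :=
  @tlift C (alg_module A) (alg_module B) G f.

Definition tmul (t u : T) : T :=
  alift (fun a b => alift (fun a' b' => apure (a * a') (b * b')) u) t.

Lemma apureDl a a' b : apure (a + a') b = apure a b + apure a' b.
Proof. exact: tpureDl. Qed.
Lemma apureDr a b b' : apure a (b + b') = apure a b + apure a b'.
Proof. exact: tpureDr. Qed.
Lemma apureZ c a b : apure (alg_str A c * a) b = apure a (alg_str B c * b).
Proof. exact: tpureZ. Qed.

Lemma apure_ind (P : T -> Prop) :
  P 0 -> (forall a b t, P t -> P (apure a b + t)) -> forall t, P t.
Proof. exact: (@tensor_ind C (alg_module A) (alg_module B)). Qed.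

Lemma tmul_bal1 (a : A) (b : B) :
  @balanced C (alg_module A) (alg_module B) T
    (fun a' b' => apure (a * (a' : A)) (b * (b' : B))).
Proof.
split=> [m m' n|m n n'|c m n].
- by rewrite mulrDr apureDl.
- by rewrite mulrDr apureDr.
rewrite /GRing.scale /= /alg_scale.
by rewrite !mulrA -!alg_strC -!mulrA apureZ.
Qed.

Lemma tmul_bal2 (u : T) :
  @balanced C (alg_module A) (alg_module B) T (fun a b =>
    alift (fun a' b' => apure ((a : A) * a') ((b : B) * b')) u).
Proof.
split=> [m m' n|m n n'|c m n].
- rewrite /alift /tlift -big_split; apply: eq_bigr => p _ /=.
  by rewrite mulrDl apureDl.
- rewrite /alift /tlift -big_split; apply: eq_bigr => p _ /=.
  by rewrite mulrDl apureDr.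
apply: eq_bigr => p _ /=; rewrite /GRing.scale /= /alg_scale.
by rewrite -!mulrA apureZ.
Qed.

Lemma tmulE a b a' b' :
  tmul (apure a b) (apure a' b') = apure (a * a') (b * b').
Proof.
exact: etrans (tliftE (tmul_bal2 _) a b) (tliftE (tmul_bal1 a b) a' b').
Qed.

Fact tmulDl : left_distributive tmul +%R.
Proof. by move=> t u v; rewrite /tmul /alift (tliftD (tmul_bal2 _)). Qed.

Fact tmulDr : right_distributive tmul +%R.
Proof.
move=> t u v; rewrite /tmul /alift /tlift -big_split; apply: eq_bigr => p _.
exact: (tliftD (tmul_bal1 _ _)).
Qed.

Lemma tmul0t t : tmul 0 t = 0.
Proof. exact: (tlift0 (tmul_bal2 _)). Qed.
Lemma tmult0 t : tmul t 0 = 0.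
Proof.
by rewrite /tmul /alift /tlift big1 // => p _; apply: (tlift0 (tmul_bal1 _ _)).
Qed.

Fact tmulA : associative tmul.
Proof.
move=> t u v.
elim/apure_ind: t => [|a b t IHt]; first by rewrite !tmul0t.
rewrite !tmulDl IHt; congr (_ + _) => {t IHt}.
elim/apure_ind: u => [|a' b' u IHu]; first by rewrite tmul0t tmult0 tmul0t.
rewrite tmulDl !tmulDr tmulDl IHu; congr (_ + _) => {u IHu}.
elim/apure_ind: v => [|c d v IHv]; first by rewrite !tmult0.
by rewrite !tmulDr IHv !tmulE !mulrA.
Qed.

Fact tmul1t : left_id (apure 1 1) tmul.
Proof.
elim/apure_ind => [|a b t IHt]; first by rewrite tmult0.
by rewrite tmulDr IHt tmulE !mul1r.
Qed.

Fact tmult1 : right_id (apure 1 1) tmul.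
Proof.
elim/apure_ind => [|a b t IHt]; first by rewrite tmul0t.
by rewrite tmulDl IHt tmulE !mulr1.
Qed.

HB.instance Definition _ := GRing.Zmodule_isPzRing.Build T
  tmulA tmul1t tmult1 tmulDl tmulDr.
End AlgTensor.

Section BaseChange.
Variables (C D : comPzRingType) (f : {rmorphism C -> D}) (A : algebra C).
Local Notation T := (alg_tensor A (alg_of_rmorphism f)).

Definition base_change_str (d : D) : T := @apure C A (alg_of_rmorphism f) 1 d.

Fact base_change_str_additive : additive base_change_str.
Proof.
move=> d e; apply: (addIr (base_change_str e)).
by rewrite subrK -apureDr subrK.
Qed.

Fact base_change_str_multiplicative : monoid_morphism base_change_str.
Proof. by split=> // d e; rewrite [RHS]tmulE mulr1. Qed.

HB.instance Definition _ := GRing.isZmodMorphism.Build D T base_change_str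
  base_change_str_additive.
HB.instance Definition _ := GRing.isMonoidMorphism.Build D T base_change_str
  base_change_str_multiplicative.

Fact base_change_strC d (t : T) :
  base_change_str d * t = t * base_change_str d.
Proof.
elim/apure_ind: t => [|a e t IHt]; first by rewrite mul0r mulr0.
rewrite mulrDl mulrDr IHt; congr (_ + _).
by rewrite [LHS]tmulE [RHS]tmulE mul1r mulr1 (mulrC (d : D)).
Qed.

Definition base_change : algebra D :=
  @Algebra D T (base_change_str : {rmorphism D -> T}) base_change_strC.

Definition base_change_can (a : A) : base_change :=
  @apure C A (alg_of_rmorphism f) a 1.
End BaseChange.

Definition sandwich (C : comPzRingType) (A : algebra C)
    (t : alg_tensor A (alg_op A)) (r : alg_module A) : alg_module A :=
  alift (fun (a : A) (b : alg_op A) =>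
    (a * (r : A) * (b : A) : alg_module A)) t.

Record azumaya (C : comPzRingType) (A : algebra C) : Prop := Azumaya {
  azumaya_faithful : faithful_module (alg_module A);
  azumaya_fg : fg_module (alg_module A);
  azumaya_projective : projective_module (alg_module A);
  azumaya_inj : forall t u : alg_tensor A (alg_op A),
    sandwich t =1 sandwich u -> t = u;
  azumaya_surj : forall phi : {linear alg_module A -> alg_module A},
    exists t : alg_tensor A (alg_op A), sandwich t =1 phi }.

Record prime_ideal (C : comPzRingType) (p : C -> Prop) : Prop := PrimeIdeal {
  prime_ideal0 : p 0;
  prime_idealD : forall a b, p a -> p b -> p (a + b);
  prime_idealM : forall a b, p b -> p (a * b);
  prime_ideal1 : ~ p 1;
  prime_idealP : forall a b, p (a * b) -> p a \/ p b }.

(* phi : C -> L is (up to isomorphism) the localization C -> C_p. *)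
Record is_localization (C : comPzRingType) (p : C -> Prop) (L : comPzRingType)
    (phi : {rmorphism C -> L}) : Prop := IsLocalization {
  loc_unit : forall s, ~ p s -> exists y, phi s * y = 1;
  loc_frac : forall x, exists a s, ~ p s /\ phi s * x = phi a;
  loc_ker : forall a, phi a = 0 -> exists s, ~ p s /\ s * a = 0 }.

(* A_p is A ⊗_C C_p. *)
Definition constant_rank (C : comPzRingType) (A : algebra C) (r : nat) :=
  forall (p : C -> Prop) (L : comPzRingType) (phi : {rmorphism C -> L}),
    prime_ideal p -> is_localization p phi ->
    free_of_rank (alg_module (base_change phi A)) r.

Definition constant_degree (C : comPzRingType) (A : algebra C) :=
  exists n : nat, constant_rank A (n ^ 2)%N.

Definition exact_at (U V W : zmodType) (u : U -> V) (v : V -> W) :=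
  forall y, v y = 0 <-> exists x, u x = y.

(* Exactness at the middle term, for arbitrary (not necessarily composing to
   zero) pairs of maps, is both preserved and reflected by tensoring with E. *)
Definition faithfully_flat (C : comPzRingType) (E : lmodType C) :=
  forall (M1 M2 M3 : lmodType C) (u : {linear M1 -> M2})
      (v : {linear M2 -> M3}),
    exact_at u v <->
    exact_at (tmap u idfun : tensor M1 E -> tensor M2 E)
             (tmap v idfun : tensor M2 E -> tensor M3 E).

Definition prod_module (C : comPzRingType) (I : Type) (M : I -> lmodType C) :
  Type := forall i, M i.

Section ProdModule.
Variables (C : comPzRingType) (I : Type) (M : I -> lmodType C).
Local Notation P := (prod_module M).

HB.instance Definition _ := Choice.copy P (forall i, M i).

Definition prod_add (x y : P) : P := fun i => x i + y i.
Definition prod_zero : P := fun i => 0.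
Definition prod_opp (x : P) : P := fun i => - x i.
Definition prod_scale (c : C) (x : P) : P := fun i => c *: x i.

Fact prod_addA : associative prod_add.
Proof.
by move=> x y z; apply: functional_extensionality_dep => i; apply: addrA.
Qed.
Fact prod_addC : commutative prod_add.
Proof.
by move=> x y; apply: functional_extensionality_dep => i; apply: addrC.
Qed.
Fact prod_add0 : left_id prod_zero prod_add.
Proof.
by move=> x; apply: functional_extensionality_dep => i; apply: add0r.
Qed.
Fact prod_addN : left_inverse prod_zero prod_opp prod_add.
Proof.
by move=> x; apply: functional_extensionality_dep => i; apply: addNr.
Qed.

HB.instance Definition _ := GRing.isZmodule.Build P
  prod_addA prod_addC prod_add0 prod_addN.

Fact prod_scaleA a b v : prod_scale a (prod_scale b v) = prod_scale (a * b) v.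
Proof. by apply: functional_extensionality_dep => i; apply: scalerA. Qed.
Fact prod_scale1 : left_id 1 prod_scale.
Proof.
by move=> x; apply: functional_extensionality_dep => i; apply: scale1r.
Qed.
Fact prod_scaleDr : right_distributive prod_scale +%R.
Proof.
by move=> a x y; apply: functional_extensionality_dep => i; apply: scalerDr.
Qed.
Fact prod_scaleDl v : {morph prod_scale^~ v : a b / a + b}.
Proof. by move=> a b; apply: functional_extensionality_dep => i; apply: scalerDl. Qed.

HB.instance Definition _ := GRing.Zmodule_isLmodule.Build C P
  prod_scaleA prod_scale1 prod_scaleDr prod_scaleDl.
End ProdModule.

Record category := Category {
  obj :> Type;
  hom : obj -> obj -> Type;
  idm : forall A, hom A A;
  comp : forall A B D, hom B D -> hom A B -> hom A D;
  comp_idl : forall A B (f : hom A B), comp (idm B) f = f;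
  comp_idr : forall A B (f : hom A B), comp f (idm A) = f;
  compA : forall A B D E (h : hom D E) (g : hom B D) (f : hom A B),
    comp h (comp g f) = comp (comp h g) f }.

Arguments hom {c} A B.
Arguments idm {c} A.
Arguments comp {c A B D} g f.

(* Everything below is phrased on a category X but describes sieves,
   topologies and sheaves on the opposite category of X. *)

Definition hom_family (X : category) (A : X) := forall B : X, hom A B -> Prop.

Definition is_sieve (X : category) (A : X) (S : hom_family A) :=
  forall (B D : X) (f : hom A B) (g : hom B D), S B f -> S D (comp g f).

Definition maximal_sieve (X : category) (A : X) : hom_family A :=
  fun _ _ => True.
Arguments maximal_sieve {X} A _ _.

Definition pull_sieve (X : category) (A B : X) (f : hom A B)
  (S : hom_family A) : hom_family B := fun D g => S D (comp g f).

Definition covering (X : category) := forall A : X, hom_family A -> Prop.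

Record grothendieck_topology (X : category) (J : covering X) : Prop :=
  GrothendieckTopology {
    topology_sieve : forall (A : X) (S : hom_family A), J A S -> is_sieve S;
    topology_maximal : forall A : X, J A (maximal_sieve A);
    topology_stable : forall (A B : X) (f : hom A B) (S : hom_family A),
      J A S -> J B (pull_sieve f S);
    topology_trans : forall (A : X) (S T : hom_family A),
      J A S -> is_sieve T ->
      (forall (B : X) (f : hom A B), S B f -> J B (pull_sieve f T)) ->
      J A T }.

Definition coarser (X : category) (J J' : covering X) :=
  forall (A : X) (S : hom_family A), J A S -> J' A S.

Definition generated_topology (X : category) (K : covering X) : covering X :=
  fun A S => forall J : covering X,
    grothendieck_topology J -> coarser K J -> J A S.

Definition sieve_of_cover (X : category) (A : X) (n : nat) (B : 'I_n -> X)
    (u : forall i, hom A (B i)) : hom_family A :=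
  fun D f => exists (i : 'I_n) (g : hom (B i) D), f = comp g (u i).

Record copresheaf (X : category) := Copresheaf {
  cop_obj :> X -> Type;
  cop_map : forall A B : X, hom A B -> cop_obj A -> cop_obj B;
  cop_id : forall (A : X) (x : cop_obj A), cop_map (idm A) x = x;
  cop_comp : forall (A B D : X) (g : hom B D) (f : hom A B) (x : cop_obj A),
    cop_map (comp g f) x = cop_map g (cop_map f x) }.

Arguments cop_map {X} F {A B} f x : rename.

Definition matching (X : category) (F : copresheaf X) (A : X)
    (S : hom_family A) (x : forall (B : X) (f : hom A B), S B f -> F B) :=
  forall (B D : X) (f : hom A B) (g : hom B D)
      (Sf : S B f) (Sgf : S D (comp g f)),
    cop_map F g (x B f Sf) = x D (comp g f) Sgf.

Definition is_sheaf (X : category) (J : covering X) (F : copresheaf X) :=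
  forall (A : X) (S : hom_family A), J A S ->
  forall x : (forall (B : X) (f : hom A B), S B f -> F B), matching x ->
  exists! s : F A, forall (B : X) (f : hom A B) (Sf : S B f),
    cop_map F f s = x B f Sf.

Section CommAlg.
Variable k : fieldType.

Record commalg := CommAlg {
  commalg_sort :> comPzRingType;
  commalg_str : {rmorphism k -> commalg_sort};
  commalg_fp : finitely_presented commalg_str }.

Definition commalg_alg (C : commalg) : algebra k :=
  alg_of_rmorphism (commalg_str C).

Definition commalg_cat : category.
Proof.
exists commalg (fun C D => alghom (commalg_alg C) (commalg_alg D))
  (fun C => alghom_id (commalg_alg C))
  (fun C D E g f => alghom_comp g f).
- by move=> C D f; apply: alghom_ext.
- by move=> C D f; apply: alghom_ext.
- by move=> C D E F h g f; apply: alghom_ext.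
Defined.

Definition commalg_rmorphism (C D : commalg_cat) (f : hom C D) :
  {rmorphism commalg_sort C -> commalg_sort D} := alghom_fun f.

(* Faithful flatness of C -> D_1 x ... x D_n only involves the product ring as a
   C-module; n = 0 gives the empty family, which covers the zero ring. *)
Inductive flat_cover : covering commalg_cat :=
  FlatCover (C : commalg_cat) (n : nat) (D : 'I_n -> commalg_cat)
      (u : forall i, hom C (D i)) of
    faithfully_flat (prod_module (fun i =>
      alg_module (alg_of_rmorphism (commalg_rmorphism (u i))))) :
    flat_cover (sieve_of_cover u).

Definition flat_topology : covering commalg_cat :=
  generated_topology flat_cover.

(* An Azumaya algebra is given together with the base ring azu_base, which
   its structure morphism identifies with its center. *)
Record azu := Azu {
  azu_base : commalg;
  azu_alg : algebra azu_base;
  azu_azumaya : azumaya azu_alg }.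

Definition azu_kalg (A : azu) : algebra k :=
  alg_restrict (commalg_str (azu_base A)) (azu_alg A).

Definition center_preserving (A B : pzRingType) (f : A -> B) :=
  forall z, is_center z -> is_center (f z).

Record azuhom (A B : azu) := Azuhom {
  azuhom_alghom :> alghom (azu_kalg A) (azu_kalg B);
  azuhom_center : center_preserving azuhom_alghom }.

Lemma azuhom_ext (A B : azu) (f g : azuhom A B) : f =1 g -> f = g.
Proof.
case: f => f Hf; case: g => g Hg /= fg.
have {fg} fg : f = g by apply: alghom_ext.
by subst g; rewrite (Prop_irrelevance Hf Hg).
Qed.

Definition azuhom_id (A : azu) : azuhom A A.
Proof. by exists (alghom_id (azu_kalg A)). Defined.

Definition azuhom_comp (A B D : azu) (g : azuhom B D) (f : azuhom A B) :
  azuhom A D.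
Proof.
exists (alghom_comp g f) => z Hz /=.
by apply: azuhom_center; apply: azuhom_center.
Defined.

Definition azumaya_cat : category.
Proof.
exists azu azuhom azuhom_id azuhom_comp.
- by move=> A B f; apply: azuhom_ext.
- by move=> A B f; apply: azuhom_ext.
- by move=> A B D E h g f; apply: azuhom_ext.
Defined.

(* The family π(L) of morphisms out of the center of A. The algebra B has center
   D because it is Azumaya over D, and g is a morphism of D-algebras. *)
Definition flat_shadow (A : azumaya_cat) (L : hom_family A) :
    @hom_family commalg_cat (azu_base A) :=
  fun (D : commalg_cat) f =>
    let AD := base_change (commalg_rmorphism f) (azu_alg A) in
    constant_degree AD /\
    exists (B : algebra (commalg_sort D)) (azuB : azumaya B)
        (g : alghom AD B) (h : @hom azumaya_cat A (@Azu D B azuB)),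
      [/\ constant_degree B, L _ h
        & forall a : azu_alg A,
            (h : azuhom _ _) a = g (base_change_can (commalg_rmorphism f) a)].

Definition max_flat_topology : covering azumaya_cat :=
  fun A L => is_sieve L /\ flat_topology (flat_shadow L).

Definition Rep (R : algebra k) : copresheaf azumaya_cat.
Proof.
exists (fun A : azu => alghom R (azu_kalg A))
  (fun A B (f : azuhom A B) (x : alghom R (azu_kalg A)) => alghom_comp f x).
- by move=> A x; apply: alghom_ext.
- by move=> A B D g f x; apply: alghom_ext.
Defined.
End CommAlg.

(* Main.v *)
Require Import Defs.
From HB Require Import structures.
From mathcomp Require Import all_boot all_order all_algebra.
From mathcomp Require Import perm boolp reals complex.
From mathcomp Require Import mpoly.
(* MathComp's [hom] would otherwise hide the one of Defs. *)
Import Defs.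

Set Implicit Arguments.
Unset Strict Implicit.
Unset Printing Implicit Defensive.

Import GRing.Theory.
Local Open Scope ring_scope.

(* Let S be a covering sieve on A, with center C, and let x be a matching family
   of morphisms x_h : R -> B for h : A -> B in S. An Azumaya algebra has a dual
   basis e_i, l_i such that l_i(a) = Σ p a q for suitable tensors Σ p ⊗ q, so for
   every h : A -> B over f : C -> D the algebra B is the tensor product of A and
   the centralizer of h(A): b = Σ h(e_i) b_i, where b_i = Σ h(p) b h(q) commutes
   with h(A).

   If h1 : A -> B1 and h2 : A -> B2 lie over the same f, then b |-> b ⊗ 1 and
   b |-> Σ h1(e_i) ⊗ b_i embed B1 and B2 into the Azumaya algebra B1 ⊗_D B2
   compatibly with h1 and h2. The matching condition then says that
   x_h1(r)_i ⊗ 1 = 1 ⊗ x_h2(r)_i, so both coefficients are the same element of D,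
   which therefore only depends on f, r and i. These elements are compatible with
   base change. As the flat topology is subcanonical (faithfully flat descent),
   they come from elements c_i(r) of C, and r |-> Σ c_i(r) e_i is the required
   morphism R -> A. *)

(** * Dual bases of Azumaya algebras *)

(** The sieve S may contain morphisms h that lie over maps f outside the shadow π(S). The
    coefficients are therefore constructed over shadow maps alone. For the remaining h, the identity
    h(Σ c_i(r) e_i) = x_h(r) is checked on coordinates in the center of B, over the pullback of the
    shadow along f, which still covers. That z ⊗ 1 = 1 ⊗ z' forces z and z' to be the same scalar
    rests on the base ring being a direct summand of every Azumaya algebra over it. The weights
    [frame_w] record a linear retraction; they come from faithfulness through Cayley-Hamilton. A is
    projective and need not be free, so an expansion along the e_i is not unique. The choice made by
    the l_i is kept throughout, and elements of A are compared through their coordinates l_i(a). The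
    map r |-> Σ c_i(r) e_i is not visibly a ring morphism. Its ring laws hold because it restricts
    to ring morphisms over the shadow, and the shadow separates the elements of A. *)

Definition abalanced (C : comPzRingType) (A B : algebra C) (G : zmodType)
    (f : A -> B -> G) :=
  [/\ forall a a' b, f (a + a') b = f a b + f a' b,
      forall a b b', f a (b + b') = f a b + f a b'
    & forall c a b, f (alg_str A c * a) b = f a (alg_str B c * b)].

Section Alift.
Variables (C : comPzRingType) (A B : algebra C) (G : zmodType).
Variables (f : A -> B -> G) (f_bal : abalanced f).

Lemma abalancedP : @balanced C (alg_module A) (alg_module B) G f.
Proof. by case: f_bal => fDl fDr fZ; split=> // c m n; apply: fZ. Qed.

Lemma aliftE a b : alift f (apure a b) = f a b.
Proof. exact: (tliftE abalancedP). Qed.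

Lemma aliftD t u : alift f (t + u) = alift f t + alift f u.
Proof. exact: (tliftD abalancedP). Qed.

Lemma alift0 : alift f 0 = 0.
Proof. exact: (tlift0 abalancedP). Qed.

Lemma alift_sum (J : Type) (s : seq J) (F : J -> alg_tensor A B) :
  alift f (\sum_(j <- s) F j) = \sum_(j <- s) alift f (F j).
Proof. by apply: big_morph; [apply: aliftD|apply: alift0]. Qed.

Lemma abalanced0l b : f 0 b = 0.
Proof. by case: f_bal => fDl _ _; apply: (addrI (f 0 b)); rewrite -fDl !addr0. Qed.

Lemma abalanced0r a : f a 0 = 0.
Proof. by case: f_bal => _ fDr _; apply: (addrI (f a 0)); rewrite -fDr !addr0. Qed.

Lemma abalanced_suml (J : Type) (s : seq J) (F : J -> A) b :
  f (\sum_(j <- s) F j) b = \sum_(j <- s) f (F j) b.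
Proof.
case: f_bal => fDl _ _; apply: (big_morph (f^~ b)); first by move=> x y; apply: fDl.
exact: abalanced0l.
Qed.

Lemma abalanced_sumr (J : Type) (s : seq J) (F : J -> B) a :
  f a (\sum_(j <- s) F j) = \sum_(j <- s) f a (F j).
Proof.
case: f_bal => _ fDr _; apply: (big_morph (f a)); first by move=> x y; apply: fDr.
exact: abalanced0r.
Qed.
End Alift.

Lemma apure_bal (C : comPzRingType) (A B : algebra C) :
  abalanced (@apure C A B).
Proof.
by split; [exact: apureDl|exact: apureDr|move=> c a b; apply: apureZ].
Qed.

Lemma alg_tensorE (C : comPzRingType) (A B : algebra C) (t : alg_tensor A B) :
  t = \sum_(p <- (repr t : seq (A * B))) apure p.1 p.2.
Proof. exact: tensorE. Qed.

Lemma apureM (C : comPzRingType) (A B : algebra C) a b a' b' :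
  (apure a b : alg_tensor A B) * apure a' b' = apure (a * a') (b * b').
Proof. exact: tmulE. Qed.

(* The finite data which witnesses that A is Azumaya: [frame_e] and [frame_l]
   form a dual basis, [frame_t i] lists the terms of the tensor of A ⊗ A^op that
   acts as [frame_l i], and [frame_w] splits the inclusion of the base ring.
   Unlike the definition of an Azumaya algebra, it visibly passes to base
   changes and tensor products. *)
Record frame (C : comPzRingType) (A : algebra C) := Frame {
  frame_idx : finType;
  frame_e : frame_idx -> A;
  frame_l : frame_idx -> A -> C;
  frame_t : frame_idx -> seq (A * A);
  frame_w : frame_idx -> C;
  frame_lD : forall i a b, frame_l i (a + b) = frame_l i a + frame_l i b;
  frame_lZ : forall i c a, frame_l i (alg_str A c * a) = c * frame_l i a;
  frame_basis : forall a, \sum_i alg_str A (frame_l i a) * frame_e i = a;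
  frame_sandwich : forall i a,
    \sum_(p <- frame_t i) p.1 * a * p.2 = alg_str A (frame_l i a);
  frame_central : forall (G : zmodType) (f : A -> A -> G), abalanced f ->
    forall i x, \sum_(p <- frame_t i) f (x * p.1) p.2 =
                \sum_(p <- frame_t i) f p.1 (p.2 * x);
  frame_unit : forall (G : zmodType) (f : A -> A -> G), abalanced f ->
    \sum_i \sum_(p <- frame_t i) f (frame_e i * p.1) p.2 = f 1 1;
  frame_split : \sum_i frame_w i * frame_l i 1 = 1 }.

Arguments frame_e {C A} F i : rename.
Arguments frame_l {C A} F i a : rename.
Arguments frame_t {C A} F i : rename.
Arguments frame_w {C A} F i : rename.

Section FrameTheory.
Variables (C : comPzRingType) (A : algebra C) (F : frame A).

(** A C-linear retraction of the structure map, normalised by [frame_split] to send 1 to 1; it is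
    not the reduced trace. *)
Definition frame_tr (a : A) : C := \sum_i frame_w F i * frame_l F i a.

Lemma frame_trD a b : frame_tr (a + b) = frame_tr a + frame_tr b.
Proof.
by rewrite /frame_tr -big_split; apply: eq_bigr => i _; rewrite frame_lD mulrDr.
Qed.

Lemma frame_trZ c a : frame_tr (alg_str A c * a) = c * frame_tr a.
Proof.
rewrite /frame_tr mulr_sumr; apply: eq_bigr => i _.
by rewrite frame_lZ mulrCA.
Qed.

Lemma frame_tr_str c : frame_tr (alg_str A c) = c.
Proof.
by rewrite -[alg_str A c]mulr1 frame_trZ [frame_tr 1]frame_split mulr1.
Qed.

Lemma frame_str_inj : injective (alg_str A).
Proof. exact: can_inj frame_tr_str. Qed.

(** For central z, Σ p z q = z Σ p q, that is l_i(z) = z l_i(1) in A; weighting by w_i and summing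
    gives z. *)
Lemma frame_center z : is_center z -> alg_str A (frame_tr z) = z.
Proof.
move=> Zz; rewrite rmorph_sum -[RHS]mulr1 -(rmorph1 (alg_str A)).
rewrite -(frame_split F) rmorph_sum mulr_sumr; apply: eq_bigr => i _.
rewrite !rmorphM [RHS]mulrA [z * _]Zz -mulrA; congr (_ * _).
rewrite -!frame_sandwich mulr_sumr; apply: eq_bigr => p _.
by rewrite mulr1 -Zz mulrA.
Qed.

Lemma frame_l0 i : frame_l F i 0 = 0.
Proof. by apply: (addrI (frame_l F i 0)); rewrite -frame_lD !addr0. Qed.

End FrameTheory.

Lemma sandwichE (C : comPzRingType) (A : algebra C) (s : seq (A * A)) r :
  sandwich (\sum_(p <- s) @apure C A (alg_op A) p.1 p.2) r =
  \sum_(p <- s) p.1 * (r : A) * p.2.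
Proof.
have bal : abalanced (B := alg_op A) (G := alg_module A)
    (fun (a : A) (b : alg_op A) => (a * (r : A) * (b : A) : alg_module A)).
  split=> [a a' b|a b b'|c a b]; first by rewrite !mulrDl.
    exact: (mulrDr (a * r) (b : A) b').
  change (alg_str A c * a * r * (b : A) = a * r * ((b : A) * alg_str A c)).
  by rewrite mulrA -alg_strC !mulrA.
rewrite /sandwich (alift_sum bal); apply: eq_bigr => p _.
exact: (aliftE bal).
Qed.

Lemma opure_bal (C : comPzRingType) (A : algebra C) :
  abalanced (fun p q : A => @apure C A (alg_op A) p q).
Proof.
split=> [a a' b|a b b'|c a b]; [exact: apureDl|exact: apureDr|].
by rewrite apureZ alg_strC.
Qed.

Lemma alift_op_bal (C : comPzRingType) (A : algebra C) (G : zmodType)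
    (f : A -> A -> G) : abalanced f -> @abalanced C A (alg_op A) G f.
Proof.
case=> fDl fDr fZ; split=> [//|//|c a b]; rewrite fZ alg_strC.
by [].
Qed.

(** * An algebra with a frame is Azumaya *)

Section FrameAzumaya.
Variables (C : comPzRingType) (A : algebra C) (F : frame A).
Local Notation opure p q := (@apure C A (alg_op A) p q).

Lemma frame_faithful : faithful_module (alg_module A).
Proof.
move=> c c0; have e : alg_str A c * 1 = 0 := c0 1.
rewrite -(frame_tr_str F c) -[alg_str A c]mulr1 e.
by rewrite /frame_tr big1 // => i _; rewrite frame_l0 mulr0.
Qed.

Lemma frame_fg : fg_module (alg_module A).
Proof.
exists #|frame_idx F|, (fun j => frame_e F (enum_val j)) => m.
exists (fun j => frame_l F (enum_val j) m).
rewrite -[LHS](frame_basis F) (reindex (fun j : 'I_#|frame_idx F| => enum_val j)) //.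
by apply: onW_bij; apply: enum_val_bij.
Qed.

Lemma frame_projective : projective_module (alg_module A).
Proof.
move=> M N g f gsurj.
have [x xP] := choice (fun i => gsurj (f (frame_e F i))).
pose h (p : alg_module A) : M := \sum_i frame_l F i p *: x i.
have hlin : linear h.
  move=> c a b; rewrite /h scaler_sumr -big_split; apply: eq_bigr => i _ /=.
  by rewrite frame_lD frame_lZ scalerDl scalerA.
pose H := GRing.isLinear.Build C (alg_module A) M *:%R h hlin.
pose h' : {linear alg_module A -> M} := HB.pack h H.
exists h' => p; rewrite /= /h linear_sum -[in RHS](frame_basis F p).
rewrite (linear_sum f); apply: eq_bigr => i _.
by rewrite linearZ /= xP -linearZ.
Qed.

(** The right-hand side depends on t only through the endomorphism it induces, which gives
    injectivity. For t = u ⊗ v, [frame_central] turns Σ u e_i v p ⊗ q into Σ u e_i p ⊗ q v, and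
    [frame_unit] collapses the latter to u ⊗ v. *)
Lemma frame_sandwich_inj (t : alg_tensor A (alg_op A)) :
  t = \sum_i \sum_(p <- frame_t F i) opure (sandwich t (frame_e F i) * p.1) p.2.
Proof.
rewrite (alg_tensorE t); move: (repr t : seq (A * A)) => s {t}.
rewrite [RHS](_ : _ = \sum_i \sum_(p <- frame_t F i)
    opure ((\sum_(u <- s) u.1 * frame_e F i * u.2) * p.1) p.2); last first.
  by apply: eq_bigr => i _; apply: eq_bigr => p _; rewrite sandwichE.
have bal := opure_bal A.
transitivity (\sum_(u <- s) \sum_i \sum_(p <- frame_t F i)
   opure (u.1 * frame_e F i * u.2 * p.1) p.2).
  apply: eq_bigr => u _.
  pose f (p q : A) := opure (u.1 * p) (q * u.2).
  have fbal : abalanced f.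
    rewrite /f; split=> [a a' b|a b b'|c a b].
    - by rewrite mulrDr apureDl.
    - by rewrite mulrDl apureDr.
    - by case: bal => _ _ balZ; rewrite !mulrA -alg_strC -mulrA balZ mulrA.
  have := frame_unit F fbal; rewrite /f mulr1 mul1r => <-.
  apply: eq_bigr => i _.
  have gbal : abalanced (fun p q : A => opure (u.1 * frame_e F i * p) q).
    split=> [a a' b|a b b'|c a b].
    - by rewrite mulrDr apureDl.
    - by rewrite apureDr.
    - by case: bal => _ _ balZ; rewrite !mulrA -alg_strC -mulrA balZ.
  have := frame_central gbal i u.2; rewrite -/(opure _ _) => gc.
  transitivity (\sum_(p <- frame_t F i) opure (u.1 * frame_e F i * p.1) (p.2 * u.2)).
    by apply: eq_bigr => p _; rewrite !mulrA.
  by rewrite -gc; apply: eq_bigr => p _; rewrite !mulrA.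
rewrite exchange_big; apply: eq_bigr => i _.
rewrite exchange_big; apply: eq_bigr => p _.
by rewrite mulr_suml (abalanced_suml bal).
Qed.

(** The tensor Σ φ(e_i) p ⊗ q acts as r |-> Σ φ(e_i) l_i(r), which is φ(r) by linearity. *)
Lemma frame_sandwich_surj (phi : {linear alg_module A -> alg_module A}) :
  exists t : alg_tensor A (alg_op A), sandwich t =1 phi.
Proof.
exists (\sum_(p <- flatten [seq [seq ((phi (frame_e F i) : A) * p.1, p.2) |
   p <- frame_t F i] | i <- enum (frame_idx F)]) opure p.1 p.2) => r.
rewrite sandwichE big_flatten big_map /= big_enum.
rewrite -[in RHS](frame_basis F r) (linear_sum phi); apply: eq_bigr => i _.
rewrite big_map.
transitivity ((phi (frame_e F i) : A) * (\sum_(p <- frame_t F i) p.1 * (r : A) * p.2)).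
  by rewrite mulr_sumr; apply: eq_bigr => p _; rewrite /= !mulrA.
rewrite frame_sandwich -alg_strC.
exact: (esym (linearZ_LR phi (frame_l F i r) (frame_e F i))).
Qed.

Lemma frame_azumaya : azumaya A.
Proof.
split; [exact: frame_faithful|exact: frame_fg|exact: frame_projective| |].
- move=> t u tu; rewrite (frame_sandwich_inj t) (frame_sandwich_inj u).
  by apply: eq_bigr => i _; apply: eq_bigr => p _; rewrite tu.
- exact: frame_sandwich_surj.
Qed.
End FrameAzumaya.

(** * An Azumaya algebra has a frame *)

Section AzumayaFrame.
Variables (C : comPzRingType) (A : algebra C).

(* Cayley-Hamilton: multiplication by 1 = \sum_j d j * e j maps A into the
   submodule generated by the d j. *)
Lemma split_of_basis (I : finType) (e : I -> A) (l : I -> A -> C) :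
  faithful_module (alg_module A) ->
  (forall a, \sum_i alg_str A (l i a) * e i = a) ->
  exists w : I -> C, \sum_i w i * l i 1 = 1.
Proof.
move=> faith basis.
pose n := #|I|; pose e' (j : 'I_n) := e (enum_val j).
pose l' (j : 'I_n) := l (enum_val j).
have basis' a : \sum_j alg_str A (l' j a) * e' j = a.
  rewrite -[RHS]basis (reindex (fun j : 'I_n => enum_val j)) //.
  by apply: onW_bij; apply: enum_val_bij.
(* The ideal generated by the l_j(1); the goal is that it contains 1. *)
pose P (c : C) := exists w : 'I_n -> C, \sum_j w j * l' j 1 = c.
have P0 : P 0 by exists (fun=> 0); rewrite big1 // => j _; rewrite mul0r.
have PD a b : P a -> P b -> P (a + b).
  move=> [u <-] [v <-]; exists (fun j => u j + v j).
  by rewrite -big_split; apply: eq_bigr => j _; rewrite mulrDl.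
have PM a b : P b -> P (a * b).
  move=> [v <-]; exists (fun j => a * v j).
  by rewrite mulr_sumr; apply: eq_bigr => j _; rewrite mulrA.
have PN a : P a -> P (- a) by rewrite -mulN1r; apply: PM.
(* The matrix of left multiplication by 1 = Σ l_i(1) e_i on the generators. Each summand has a
   factor l_i(1), so all entries lie in the ideal [P], while the rows express e_j = Σ_k N_jk e_k. *)
pose N : 'M[C]_n := \matrix_(j, k) \sum_i l' i 1 * l' k (e' i * e' j).
have PNjk j k : P (N j k).
  rewrite mxE; apply: big_ind => // i _.
  rewrite mulrC; apply: PM; exists (fun i' => (i' == i)%:R).
  by rewrite (bigD1 i) //= eqxx mul1r big1 ?addr0 // => i' /negPf->; rewrite mul0r.
have eN j : e' j = \sum_k alg_str A (N j k) * e' k.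
  rewrite -[LHS]mul1r -[in LHS](basis' 1) mulr_suml.
  transitivity (\sum_k \sum_i alg_str A (l' i 1 * l' k (e' i * e' j)) * e' k).
    rewrite exchange_big; apply: eq_bigr => i _.
    rewrite -mulrA -[in LHS](basis' (e' i * e' j)) mulr_sumr.
    by apply: eq_bigr => k _; rewrite rmorphM mulrA.
  by apply: eq_bigr => k _; rewrite mxE rmorph_sum mulr_suml.
pose M : 'M[C]_n := 1%:M - N.
have M0 j : \sum_k alg_str A (M j k) * e' k = 0.
  transitivity (\sum_k (alg_str A (1%:M j k : C) * e' k - alg_str A (N j k) * e' k)).
    by apply: eq_bigr => k _; rewrite -mulrBl -rmorphB !mxE.
  rewrite sumrB; apply/eqP; rewrite subr_eq0; apply/eqP.
  rewrite -[RHS](eN j) (bigD1 j) //= mxE eqxx rmorph1 mul1r big1 ?addr0 // => k.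
  by rewrite mxE eq_sym => /negPf->; rewrite rmorph0 mul0r.
(* Multiplying by the adjugate shows that det(1 - N) kills every generator, hence all of A, and A is
   faithful. *)
have det0 : \det M = 0.
  apply: faith => m; rewrite -[LHS]/(alg_str A (\det M) * (m : A)).
  rewrite -(basis' m) mulr_sumr big1 // => k _.
  rewrite mulrA -rmorphM mulrC rmorphM -mulrA.
  rewrite (_ : alg_str A (\det M) * e' k = 0) ?mulr0 //.
  transitivity (\sum_j alg_str A (\adj M k j) * \sum_i alg_str A (M j i) * e' i).
    under eq_bigr => j _ do rewrite mulr_sumr.
    rewrite exchange_big /=.
    transitivity (\sum_i alg_str A ((\adj M *m M) k i) * e' i).
      rewrite mul_adj_mx (bigD1 k) //= mxE eqxx mulr1n big1 ?addr0 // => i.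
      by rewrite eq_sym mxE => /negPf->; rewrite mulr0n rmorph0 mul0r.
    apply: eq_bigr => i _; rewrite mxE rmorph_sum mulr_suml.
    by apply: eq_bigr => j _; rewrite rmorphM mulrA.
  by rewrite big1 // => j _; rewrite M0 mulr0.
(* Congruence modulo the ideal [P]: there 1 - N becomes the identity matrix, so 0 = det(1 - N) is
   congruent to 1. *)
pose R (a b : C) := P (a - b).
have Rrefl a : R a a by rewrite /R subrr.
have RD a b a' b' : R a b -> R a' b' -> R (a + a') (b + b').
  by move=> ab a'b'; rewrite /R opprD addrACA; apply: PD.
have RM a b a' b' : R a b -> R a' b' -> R (a * a') (b * b').
  move=> ab a'b'; rewrite /R.
  have -> : a * a' - b * b' = a * (a' - b') + b' * (a - b).
    by rewrite !mulrBr (mulrC b' a) addrA subrK (mulrC b' b).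
  by apply: PD; apply: PM.
have : R (\det M) (\det (1%:M : 'M[C]_n)).
  rewrite /determinant; apply: (big_ind2 R) => // s _.
  apply: (RM) => //; apply: (big_ind2 R) => // i _.
  move: (PNjk i (fun_of_perm s i)); rewrite /R /M !mxE addrAC subrr sub0r => Ps.
  exact: PN.
rewrite det0 det1 /R sub0r => /PN; rewrite opprK => -[w w1].
exists (fun i => w (enum_rank i)); rewrite -[RHS]w1 (reindex (fun j : 'I_n => enum_val j)).
  by apply: eq_bigr => j _; rewrite enum_valK.
by apply: onW_bij; apply: enum_val_bij.
Qed.

(** A linear section of C^n -> A provides the dual basis. Since a |-> l_i(a) 1 is an endomorphism of
    A, it is the action of a tensor, whose terms become [frame_t i]. The two tensor identities hold
    because both sides induce the same endomorphism: r |-> x l_i(r) for [frame_central], the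
    identity for [frame_unit]. *)
Lemma azumaya_frame : azumaya A -> inhabited (frame A).
Proof.
case=> faith [n [g gP]] proj inj surj.
pose u (v : 'rV[C]_n) : alg_module A := \sum_i v 0 i *: g i.
have ulin : linear u.
  move=> c a b; rewrite /u scaler_sumr -big_split; apply: eq_bigr => i _.
  by rewrite !mxE scalerDl scalerA.
pose U := GRing.isLinear.Build C 'rV[C]_n (alg_module A) *:%R u ulin.
pose u' : {linear 'rV[C]_n -> alg_module A} := HB.pack u U.
have usurj y : exists x, u' x = y.
  have [c ->] := gP y; exists (\row_i c i) => /=.
  by apply: eq_bigr => i _; rewrite mxE.
have [h hP] := proj _ _ u' idfun usurj.
pose l i (a : A) : C := h a 0 i.
have lD i a b : l i (a + b) = l i a + l i b by rewrite /l (linearD h) mxE.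
have lZ i c a : l i (alg_str A c * a) = c * l i a.
  by rewrite /l (linearZ_LR h c a) mxE.
have basis a : \sum_i alg_str A (l i a) * (g i : A) = a by apply: hP.
have [w wP] := split_of_basis faith basis.
pose phi i (a : alg_module A) : alg_module A := alg_str A (l i a).
have philin i : linear (phi i).
  by move=> c a b; rewrite /phi lD lZ rmorphD rmorphM.
pose phi' i : {linear alg_module A -> alg_module A} := HB.pack (phi i)
  (GRing.isLinear.Build C (alg_module A) (alg_module A) *:%R (phi i) (philin i)).
have [t tP] := choice (fun i => surj (phi' i)).
pose s i := repr (t i) : seq (A * A).
have tE i : t i = \sum_(p <- s i) @apure C A (alg_op A) p.1 p.2.
  exact: alg_tensorE.
have sandP i a : \sum_(p <- s i) p.1 * a * p.2 = alg_str A (l i a).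
  by rewrite -sandwichE -tE tP.
have central i x : \sum_(p <- s i) @apure C A (alg_op A) (x * p.1) p.2 =
    \sum_(p <- s i) @apure C A (alg_op A) p.1 (p.2 * x).
  apply: inj => r.
  have := sandwichE [seq (x * p.1, p.2) | p <- s i] r; rewrite !big_map /= => ->.
  have := sandwichE [seq (p.1, p.2 * x) | p <- s i] r; rewrite !big_map /= => ->.
  transitivity (x * \sum_(p <- s i) p.1 * (r : A) * p.2).
    by rewrite mulr_sumr; apply: eq_bigr => p _; rewrite !mulrA.
  rewrite sandP -alg_strC -sandP mulr_suml.
  by apply: eq_bigr => p _; rewrite !mulrA.
have unit : \sum_i \sum_(p <- s i) @apure C A (alg_op A) ((g i : A) * p.1) p.2 =
    @apure C A (alg_op A) 1 1.
  apply: inj => r.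
  have := sandwichE [seq ((g i : A) * p.1, p.2) | i <- enum 'I_n, p <- s i] r.
  rewrite !big_allpairs_dep /= !big_enum /= => ->.
  have := sandwichE [:: (1 : A, 1 : A)] r; rewrite !big_seq1 /= => ->.
  rewrite mulr1 mul1r -[RHS](basis r); apply: eq_bigr => i _.
  rewrite alg_strC -sandP mulr_sumr.
  by apply: eq_bigr => p _; rewrite /= !mulrA.
have liftE (G : zmodType) (f : A -> A -> G) (fbal : abalanced f) p q :
    @alift C A (alg_op A) G f (@apure C A (alg_op A) p q) = f p q.
  exact: (aliftE (alift_op_bal fbal)).
constructor; refine (@Frame C A 'I_n g l s w lD lZ basis sandP _ _ wP).
- move=> G f fbal i x; have := congr1 (@alift C A (alg_op A) G f) (central i x).
  rewrite !(alift_sum (alift_op_bal fbal)).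
  move=> e; apply: etrans (etrans _ e) _; apply: eq_bigr => p _;
    by rewrite (liftE _ _ fbal).
- move=> G f fbal; have := congr1 (@alift C A (alg_op A) G f) unit.
  rewrite (liftE _ _ fbal) (alift_sum (alift_op_bal fbal)) => <-.
  apply: eq_bigr => i _; rewrite (alift_sum (alift_op_bal fbal)).
  by apply: eq_bigr => p _; rewrite (liftE _ _ fbal).
Qed.
End AzumayaFrame.

(** * Base change and tensor products *)

Lemma apure0r (C : comPzRingType) (A B : algebra C) a :
  apure a 0 = 0 :> alg_tensor A B.
Proof. exact: (abalanced0r (apure_bal A B)). Qed.

Section BaseChangeFrame.
Variables (C D : comPzRingType) (f : {rmorphism C -> D}) (A : algebra C).
Variable F : frame A.
Local Notation AD := (base_change f A).
Local Notation bpure a d := (@apure C A (alg_of_rmorphism f) a d : AD).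

Lemma base_changeM a d a' d' : bpure a d * bpure a' d' = bpure (a * a') (d * d').
Proof. exact: apureM. Qed.

Lemma base_change_strE d : alg_str AD d = bpure 1 d.
Proof. by []. Qed.

Lemma base_change_pureZ d a d' : alg_str AD d * bpure a d' = bpure a (d * d').
Proof. by rewrite base_change_strE base_changeM mul1r. Qed.

Lemma base_change_pureE a d : bpure a d = alg_str AD d * bpure a 1.
Proof. by rewrite base_change_pureZ mulr1. Qed.

Let l i (a : A) (d : alg_of_rmorphism f) : D := f (frame_l F i a) * d.

Lemma base_change_l_bal i : abalanced (l i).
Proof.
rewrite /l; split=> [a a' d|a d d'|c a d].
- by rewrite frame_lD rmorphD mulrDl.
- by rewrite mulrDr.
- by rewrite frame_lZ rmorphM mulrA (mulrC (f c)) -mulrA.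
Qed.

Definition base_change_l i : AD -> D := alift (l i).

Lemma base_change_lE i a d : base_change_l i (bpure a d) = f (frame_l F i a) * d.
Proof. exact: (aliftE (base_change_l_bal i)). Qed.

Lemma base_change_lD i a b :
  base_change_l i (a + b) = base_change_l i a + base_change_l i b.
Proof. exact: (aliftD (base_change_l_bal i)). Qed.

Lemma base_change_l0 i : base_change_l i 0 = 0.
Proof. exact: (alift0 (base_change_l_bal i)). Qed.

(** [frame_central] and [frame_unit] are tested against all balanced maps, so a balanced map on the
    base change is restricted to A and no identification of the base change of A ⊗ A^op is
    involved. *)
Lemma base_change_frame : frame AD.
Proof.
refine (@Frame D AD (frame_idx F) (fun i => bpure (frame_e F i) 1)
  base_change_l (fun i => [seq (bpure p.1 1, bpure p.2 1) | p <- frame_t F i])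
  (fun i => f (frame_w F i)) base_change_lD _ _ _ _ _ _).
- move=> i d; elim/apure_ind => [|a d' t IHt].
    by rewrite mulr0 base_change_l0 mulr0.
  rewrite mulrDr !base_change_lD mulrDr IHt; congr (_ + _).
  by rewrite -[_ * apure a d']/(_ * bpure a d') base_change_pureZ !base_change_lE mulrCA.
- elim/apure_ind => [|a d t IHt].
    by rewrite big1 // => i _; rewrite base_change_l0 rmorph0 mul0r.
  rewrite -[in RHS]IHt -[in RHS](frame_basis F a) (abalanced_suml (apure_bal _ _)).
  rewrite -big_split; apply: eq_bigr => i _.
  rewrite base_change_lD rmorphD mulrDl; congr (_ + _).
  rewrite base_change_lE base_change_pureZ mulr1.
  by rewrite /= apureZ.
- move=> i; elim/apure_ind => [|a d t IHt].
    by rewrite base_change_l0 rmorph0 big1 // => p _; rewrite mulr0 mul0r.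
  rewrite base_change_lD rmorphD -IHt.
  transitivity (\sum_(p <- [seq (bpure p.1 1, bpure p.2 1) | p <- frame_t F i])
     (p.1 * bpure a d * p.2 + p.1 * t * p.2)).
    by apply: eq_bigr => p _; rewrite mulrDr mulrDl.
  rewrite big_split; congr (_ + _).
  rewrite big_map base_change_lE.
  transitivity (\sum_(p <- frame_t F i) bpure (p.1 * a * p.2) d).
    by apply: eq_bigr => p _; rewrite !base_changeM mul1r mulr1.
  rewrite -(abalanced_suml (apure_bal _ _)) frame_sandwich.
  by rewrite base_change_strE -[alg_str A _]mulr1 apureZ.
- move=> G g [gDl gDr gZ] i; have gb : abalanced g by [].
  elim/apure_ind => [|a d t IHt].
    by apply: eq_bigr => p _; rewrite mul0r mulr0 (abalanced0l gb) (abalanced0r gb).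
  under eq_bigr do rewrite mulrDl gDl; under [RHS]eq_bigr do rewrite mulrDr gDr.
  rewrite !big_split IHt; congr (_ + _).
  rewrite !big_map.
  have hb : abalanced (fun p q : A => g (bpure p d) (bpure q 1)).
    split=> [p p' q|p q q'|c p q].
    - by rewrite apureDl gDl.
    - by rewrite apureDl gDr.
    - rewrite !apureZ [X in g X _](_ : _ = alg_str AD (f c) * bpure p d).
        by rewrite gZ base_change_pureZ.
      by rewrite base_change_pureZ.
  transitivity (\sum_(p <- frame_t F i) g (bpure (a * p.1) d) (bpure p.2 1)).
    by apply: eq_bigr => p _; rewrite base_changeM mulr1.
  rewrite (frame_central hb); apply: eq_bigr => p _ /=.
  by rewrite (base_change_pureE p.1) gZ base_change_pureZ base_changeM mul1r mulr1.
- move=> G g [gDl gDr gZ].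
  have hb : abalanced (fun p q : A => g (bpure p 1) (bpure q 1)).
    split=> [p p' q|p q q'|c p q].
    - by rewrite apureDl gDl.
    - by rewrite apureDl gDr.
    - rewrite !apureZ [X in g X _](_ : _ = alg_str AD (f c) * bpure p 1).
        by rewrite gZ base_change_pureZ.
      by rewrite base_change_pureZ.
  rewrite -[RHS](frame_unit F hb); apply: eq_bigr => i _; rewrite big_map.
  by apply: eq_bigr => p _; rewrite base_changeM mul1r.
- rewrite -(rmorph1 f) -(frame_split F) rmorph_sum; apply: eq_bigr => i _.
  by rewrite base_change_lE rmorphM mulr1.
Qed.
End BaseChangeFrame.

Section TensorAlgebra.
Variables (C : comPzRingType) (A B : algebra C).
Local Notation T := (alg_tensor A B).

Definition tensor_str (c : C) : T := apure (alg_str A c) 1.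

Fact tensor_str_additive : zmod_morphism tensor_str.
Proof.
move=> c d; apply: (addIr (tensor_str d)).
by rewrite subrK -apureDl -rmorphD subrK.
Qed.

Fact tensor_str_multiplicative : monoid_morphism tensor_str.
Proof.
rewrite /tensor_str; split=> [|c d]; first by rewrite rmorph1.
by rewrite apureM -rmorphM mulr1.
Qed.

HB.instance Definition _ := GRing.isZmodMorphism.Build C T tensor_str
  tensor_str_additive.
HB.instance Definition _ := GRing.isMonoidMorphism.Build C T tensor_str
  tensor_str_multiplicative.

Fact tensor_strC c (t : T) : tensor_str c * t = t * tensor_str c.
Proof.
elim/apure_ind: t => [|a b t IHt]; first by rewrite mul0r mulr0.
rewrite mulrDl mulrDr IHt /tensor_str; congr (_ + _).
by rewrite !apureM alg_strC mul1r mulr1.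
Qed.

Definition tensor_algebra : algebra C :=
  @Algebra C T (tensor_str : {rmorphism C -> T}) tensor_strC.

Local Notation tpure a b := (@apure C A B a b : tensor_algebra).

Lemma tensor_strZl c a b :
  alg_str tensor_algebra c * tpure a b = tpure (alg_str A c * a) b.
Proof. by rewrite [LHS]apureM mul1r. Qed.

Lemma tensor_strZr c a b :
  alg_str tensor_algebra c * tpure a b = tpure a (alg_str B c * b).
Proof. by rewrite tensor_strZl apureZ. Qed.

Variables (F : frame A) (F' : frame B).

Let l (i : frame_idx F * frame_idx F') (a : A) (b : B) : C :=
  frame_l F i.1 a * frame_l F' i.2 b.

Lemma tensor_l_bal i : abalanced (l i).
Proof.
rewrite /l; split=> [a a' b|a b b'|c a b].
- by rewrite frame_lD mulrDl.
- by rewrite frame_lD mulrDr.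
- by rewrite !frame_lZ mulrCA mulrA.
Qed.

Definition tensor_l i : tensor_algebra -> C := alift (l i).

Lemma tensor_lE i a b :
  tensor_l i (tpure a b) = frame_l F i.1 a * frame_l F' i.2 b.
Proof. exact: (aliftE (tensor_l_bal i)). Qed.

Lemma tensor_lD i a b : tensor_l i (a + b) = tensor_l i a + tensor_l i b.
Proof. exact: (aliftD (tensor_l_bal i)). Qed.

Lemma tensor_l0 i : tensor_l i 0 = 0.
Proof. exact: (alift0 (tensor_l_bal i)). Qed.

(** The product of the two frames. Each tensor identity follows by using those of A and of B in
    turn, with the arguments from the other factor frozen. *)
Lemma tensor_frame : frame tensor_algebra.
Proof.
pose tt i := [seq (tpure p.1 q.1, tpure p.2 q.2) |
  p <- frame_t F i.1, q <- frame_t F' i.2].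
have bal := apure_bal A B.
refine (@Frame C tensor_algebra _ (fun i => tpure (frame_e F i.1) (frame_e F' i.2))
  tensor_l tt (fun i => frame_w F i.1 * frame_w F' i.2) tensor_lD _ _ _ _ _ _).
- move=> i c; elim/apure_ind => [|a b t IHt].
    by rewrite mulr0 tensor_l0 mulr0.
  rewrite mulrDr !tensor_lD mulrDr IHt tensor_strZl; congr (_ + _).
  by rewrite !tensor_lE frame_lZ mulrA.
- elim/apure_ind => [|a b t IHt].
    by rewrite big1 // => i _; rewrite tensor_l0 rmorph0 mul0r.
  under eq_bigr do rewrite tensor_lD rmorphD mulrDl.
  rewrite big_split /= IHt; congr (_ + _).
  rewrite -[in RHS](frame_basis F a) (abalanced_suml bal).
  rewrite -(pair_bigA _ (fun i j => alg_str tensor_algebra (tensor_l (i, j) (apure a b)) *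
     apure (frame_e F i) (frame_e F' j))) /=; apply: eq_bigr => i _.
  rewrite -[in RHS](frame_basis F' b) (abalanced_sumr bal); apply: eq_bigr => j _.
  by rewrite tensor_lE rmorphM -mulrA tensor_strZr tensor_strZl.
- move=> i; elim/apure_ind => [|a b t IHt].
    by rewrite tensor_l0 rmorph0 big1 // => p _; rewrite mulr0 mul0r.
  rewrite tensor_lD rmorphD -IHt.
  under eq_bigr do rewrite mulrDr mulrDl.
  rewrite big_split; congr (_ + _).
  rewrite big_allpairs_dep /= tensor_lE.
  transitivity (tpure (alg_str A (frame_l F i.1 a)) (alg_str B (frame_l F' i.2 b))).
    rewrite -!frame_sandwich (abalanced_suml bal); apply: eq_bigr => p _.
    rewrite (abalanced_sumr bal); apply: eq_bigr => q _.
    by rewrite -[LHS]/(apure p.1 q.1 * apure a b * apure p.2 q.2) !apureM.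
  rewrite -[alg_str A _]mulr1 -[alg_str B _]mulr1 -tensor_strZl -tensor_strZr.
  by rewrite mulrA -rmorphM; apply: mulr1.
- move=> G g [gDl gDr gZ] i; have gb : abalanced g by [].
  elim/apure_ind => [|a b t IHt].
    by apply: eq_bigr => p _; rewrite mul0r mulr0 (abalanced0l gb) (abalanced0r gb).
  transitivity (\sum_(p <- tt i) (g (tpure a b * p.1) p.2 + g (t * p.1) p.2)).
    by apply: eq_bigr => p _; rewrite -gDl -mulrDl.
  transitivity (\sum_(p <- tt i) (g p.1 (p.2 * tpure a b) + g p.1 (p.2 * t))); last first.
    by apply: eq_bigr => p _; rewrite -gDr -mulrDr.
  rewrite !big_split IHt; congr (_ + _).
  rewrite !big_allpairs_dep /=.
  transitivity (\sum_(p <- frame_t F i.1) \sum_(q <- frame_t F' i.2)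
     g (tpure (a * p.1) (b * q.1)) (tpure p.2 q.2)).
    by apply: eq_bigr => p _; apply: eq_bigr => q _;
      rewrite -[tpure (a * _) _]apureM.
  transitivity (\sum_(p <- frame_t F i.1) \sum_(q <- frame_t F' i.2)
     g (tpure p.1 (b * q.1)) (tpure (p.2 * a) q.2)).
    rewrite exchange_big [RHS]exchange_big; apply: eq_bigr => q _.
    apply: (frame_central (f := fun p p' : A => g (tpure p (b * q.1)) (tpure p' q.2))).
    split=> [p p' r|p r r'|c p r].
    - by rewrite apureDl gDl.
    - by rewrite apureDl gDr.
    - by rewrite -!tensor_strZl gZ.
  apply: eq_bigr => p _.
  rewrite (frame_central (f := fun q q' : B => g (tpure p.1 q) (tpure (p.2 * a) q'))).
    by apply: eq_bigr => q _; rewrite -[tpure (p.2 * a) _]apureM.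
  split=> [q q' r|q r r'|c q r].
  - by rewrite apureDr gDl.
  - by rewrite apureDr gDr.
  - by rewrite -!tensor_strZr gZ.
- move=> G g [gDl gDr gZ].
  rewrite -(pair_bigA _ (fun i j => \sum_(p <- tt (i, j))
     g (tpure (frame_e F i) (frame_e F' j) * p.1) p.2)) /=.
  transitivity (\sum_i \sum_(p <- frame_t F i)
      g (tpure (frame_e F i * p.1) 1) (tpure p.2 1)).
    apply: eq_bigr => i _.
    under eq_bigr do rewrite big_allpairs_dep /=.
    rewrite exchange_big; apply: eq_bigr => p _.
    rewrite -(frame_unit F' (f := fun q q' : B =>
       g (tpure (frame_e F i * p.1) q) (tpure p.2 q'))).
      apply: eq_bigr => j _; apply: eq_bigr => q _.
      by rewrite -[tpure (_ * _) _]apureM.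
    split=> [q q' r|q r r'|c q r].
    - by rewrite apureDr gDl.
    - by rewrite apureDr gDr.
    - by rewrite -!tensor_strZr gZ.
  rewrite (frame_unit F (f := fun p p' : A => g (tpure p 1) (tpure p' 1))) //.
  split=> [p p' r|p r r'|c p r].
  - by rewrite apureDl gDl.
  - by rewrite apureDl gDr.
  - by rewrite -!tensor_strZl gZ.
- rewrite -(pair_bigA _ (fun i j => frame_w F i * frame_w F' j *
    tensor_l (i, j) (tpure 1 1))) /= -[RHS]mulr1 -[X in X * _](frame_split F).
  rewrite -(frame_split F') mulr_suml; apply: eq_bigr => i _.
  rewrite mulr_sumr; apply: eq_bigr => j _; rewrite tensor_lE /=.
  by rewrite mulrACA.
Qed.
End TensorAlgebra.

(** * Pushouts of finitely presented algebras *)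

Section Pushout.
Variables (C C' D : comPzRingType).
Variables (f : {rmorphism C -> C'}) (g : {rmorphism C -> D}).
Local Notation A := (alg_of_rmorphism f).
Local Notation B := (alg_of_rmorphism g).

(** A separate name for this tensor product, to which the commutative ring structure is attached. *)
Definition pushout : Type := alg_tensor A B.

HB.instance Definition _ := GRing.PzRing.copy pushout (alg_tensor A B).

Definition ppure (c : C') (d : D) : pushout := @apure C A B c d.

Fact pushout_mulC : commutative (@GRing.mul pushout).
Proof.
move=> t u; elim/apure_ind: t => [|c d t IHt]; first by rewrite mul0r mulr0.
rewrite mulrDl mulrDr IHt; congr (_ + _).
elim/apure_ind: u {IHt} => [|c' d' u IHu]; first by rewrite mul0r mulr0.
rewrite mulrDl mulrDr IHu; congr (_ + _).
by rewrite [LHS]apureM [RHS]apureM [in LHS]mulrC [X in apure _ X]mulrC.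
Qed.

HB.instance Definition _ :=
  GRing.PzRing_hasCommutativeMul.Build pushout pushout_mulC.

Lemma ppureM c d c' d' : ppure c d * ppure c' d' = ppure (c * c') (d * d').
Proof. exact: apureM. Qed.

Lemma ppureZ e c d : ppure (f e * c) d = ppure c (g e * d).
Proof. exact: (@apureZ C A B). Qed.

Definition pushl (c : C') : pushout := ppure c 1.
Definition pushr (d : D) : pushout := ppure 1 d.

Fact pushl_additive : zmod_morphism pushl.
Proof. by move=> a b; apply: (addIr (pushl b)); rewrite subrK -[LHS]apureDl subrK. Qed.
Fact pushl_multiplicative : monoid_morphism pushl.
Proof. by split=> // a b; rewrite /pushl ppureM mulr1. Qed.
HB.instance Definition _ := GRing.isZmodMorphism.Build C' pushout pushl
  pushl_additive.
HB.instance Definition _ := GRing.isMonoidMorphism.Build C' pushout pushl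
  pushl_multiplicative.

Fact pushr_additive : zmod_morphism pushr.
Proof. by move=> a b; apply: (addIr (pushr b)); rewrite subrK -[LHS]apureDr subrK. Qed.
Fact pushr_multiplicative : monoid_morphism pushr.
Proof. by split=> // a b; rewrite /pushr ppureM mulr1. Qed.
HB.instance Definition _ := GRing.isZmodMorphism.Build D pushout pushr
  pushr_additive.
HB.instance Definition _ := GRing.isMonoidMorphism.Build D pushout pushr
  pushr_multiplicative.

Lemma ppureE c d : ppure c d = pushl c * pushr d.
Proof. by rewrite ppureM mulr1 mul1r. Qed.

Lemma pushout_comm c : pushl (f c) = pushr (g c).
Proof. by have := ppureZ c 1 1; rewrite !mulr1. Qed.

Lemma pushout_ind (P : pushout -> Prop) :
  P 0 -> (forall c d t, P t -> P (ppure c d + t)) -> forall t, P t.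
Proof. exact: (@apure_ind C A B). Qed.

Section Copair.
Variables (E : comPzRingType) (u : {rmorphism C' -> E}) (v : {rmorphism D -> E}).
Hypothesis uv : forall c, u (f c) = v (g c).

Let uv_mul (c : A) (d : B) : E := u c * v d.

Lemma copair_bal : abalanced uv_mul.
Proof.
split=> [a a' b|a b b'|c a b]; rewrite /uv_mul; first by rewrite rmorphD mulrDl.
  by rewrite rmorphD mulrDr.
by rewrite [in LHS]rmorphM [in RHS]rmorphM uv -mulrA mulrCA.
Qed.

Definition copair : pushout -> E := alift uv_mul.

Lemma copairE c d : copair (ppure c d) = u c * v d.
Proof. exact: (aliftE copair_bal). Qed.

Lemma copairD : {morph copair : a b / a + b}.
Proof. exact: (aliftD copair_bal). Qed.

Lemma copair0 : copair 0 = 0.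
Proof. exact: (alift0 copair_bal). Qed.

Fact copair_additive : zmod_morphism copair.
Proof. by move=> a b; apply: (addIr (copair b)); rewrite subrK -copairD subrK. Qed.

Fact copair_multiplicative : monoid_morphism copair.
Proof.
split=> [|a b]; first by rewrite [LHS]copairE !rmorph1 mulr1.
elim/pushout_ind: a => [|c d a IHa]; first by rewrite mul0r copair0 mul0r.
rewrite mulrDl !copairD mulrDl IHa; congr (_ + _).
elim/pushout_ind: b {IHa} => [|c' d' b IHb]; first by rewrite mulr0 copair0 mulr0.
rewrite mulrDr !copairD mulrDr IHb ppureM !copairE !rmorphM; congr (_ + _).
by rewrite mulrACA.
Qed.

Definition copair_rmorphism : {rmorphism pushout -> E} :=
  HB.pack copair (GRing.isZmodMorphism.Build pushout E copair copair_additive)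
   (GRing.isMonoidMorphism.Build pushout E copair copair_multiplicative).
End Copair.
End Pushout.

Lemma mpoly_gen_ind (k : fieldType) (n : nat) (P : {mpoly k[n]} -> Prop) :
  (forall c, P c%:MP) -> (forall i, P 'X_i) ->
  (forall p q, P p -> P q -> P (p + q)) ->
  (forall p q, P p -> P q -> P (p * q)) -> forall p, P p.
Proof.
move=> PC PX PD PM; elim/mpolyind => [|c m p _ _ Pp]; first by rewrite -mpolyC0.
apply: (PD) => //; rewrite -mul_mpolyC; apply: (PM) => //.
rewrite mpolyXE_id; elim/big_ind: _ => [|x y|i _]; [by rewrite -mpolyC1|exact: PM|].
by elim: (m i) => [|j IHj]; rewrite ?expr0 -?mpolyC1 // exprS; apply: PM.
Qed.

Lemma mpoly_eval (k : fieldType) (n : nat) (S : comPzRingType)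
    (s : {rmorphism k -> S}) (h : 'I_n -> S) :
  exists p : {rmorphism {mpoly k[n]} -> S},
    (forall c, p c%:MP = s c) /\ (forall i, p 'X_i = h i).
Proof.
(* Evaluation by [mmap] takes values in a nonzero ring, so the zero ring is treated apart. *)
have [S0|/eqP S1] := pselect (1 = 0 :> S).
  have triv (x y : S) : x = y by rewrite -[x]mulr1 -[y]mulr1 S0 !mulr0.
  pose z (_ : {mpoly k[n]}) : S := 0.
  have za : zmod_morphism z by move=> a b; apply: triv.
  have zm : monoid_morphism z by split=> [|a b]; apply: triv.
  pose z' : {rmorphism {mpoly k[n]} -> S} := HB.pack z
    (GRing.isZmodMorphism.Build _ _ z za) (GRing.isMonoidMorphism.Build _ _ z zm).
  by exists z'; split=> *; apply: triv.
pose N := GRing.PzSemiRing_isNonZero.Build S S1.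
pose S' : comNzRingType := HB.pack (S : Type) (GRing.ComPzRing.on S) N.
pose s' : {rmorphism k -> S'} := s.
pose p : {rmorphism {mpoly k[n]} -> S'} := mmap s' (h : 'I_n -> S').
exists (p : {rmorphism {mpoly k[n]} -> S}).
split=> [c|i]; first exact: (@mmapC n k S' h s' c).
exact: (etrans (@mmapX n k S' h s' _) (@mmap1U n S' h i)).
Qed.

Lemma mpoly_rmorphism_ext (k : fieldType) (n : nat) (S : pzRingType)
    (p q : {rmorphism {mpoly k[n]} -> S}) :
  (forall c, p c%:MP = q c%:MP) -> (forall i, p 'X_i = q 'X_i) -> p =1 q.
Proof.
move=> pqC pqX; elim/mpoly_gen_ind => // a b pa pb.
  by rewrite !rmorphD pa pb.
by rewrite !rmorphM pa pb.
Qed.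

Section IdealSpan.
Variables (S : comPzRingType) (J : finType) (G : J -> S).

Definition ideal_span (q : S) := exists h : J -> S, q = \sum_j h j * G j.

Lemma ideal_span0 : ideal_span 0.
Proof. by exists (fun=> 0); rewrite big1 // => j _; rewrite mul0r. Qed.

Lemma ideal_spanD a b : ideal_span a -> ideal_span b -> ideal_span (a + b).
Proof.
move=> [u ->] [v ->]; exists (fun j => u j + v j).
by rewrite -big_split; apply: eq_bigr => j _; rewrite mulrDl.
Qed.

Lemma ideal_spanM a b : ideal_span b -> ideal_span (a * b).
Proof.
move=> [v ->]; exists (fun j => a * v j).
by rewrite mulr_sumr; apply: eq_bigr => j _; rewrite mulrA.
Qed.

Lemma ideal_spanN a : ideal_span a -> ideal_span (- a).
Proof. by rewrite -mulN1r; apply: ideal_spanM. Qed.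

Lemma ideal_span_gen j : ideal_span (G j).
Proof.
exists (fun i => (i == j)%:R).
by rewrite (bigD1 j) //= eqxx mul1r big1 ?addr0 // => i /negPf->; rewrite mul0r.
Qed.

Lemma ideal_span_congrM a a' b b' :
  ideal_span (a - a') -> ideal_span (b - b') -> ideal_span (a * b - a' * b').
Proof.
move=> aa' bb'; have -> : a * b - a' * b' = b * (a - a') + a' * (b - b').
  by rewrite !mulrBr (mulrC b a) (mulrC b a') addrA subrK.
by apply: ideal_spanD; apply: ideal_spanM.
Qed.

Lemma ideal_span_trans b a c :
  ideal_span (a - b) -> ideal_span (b - c) -> ideal_span (a - c).
Proof. by move=> ab bc; rewrite -(subrK b a) -addrA; apply: ideal_spanD. Qed.

Lemma ideal_span_sym a b : ideal_span (a - b) -> ideal_span (b - a).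
Proof. by move=> ab; rewrite -opprB; apply: ideal_spanN. Qed.

Lemma ideal_span_ord : exists (m : nat) (g : 'I_m -> S), forall q,
  ideal_span q <-> exists h : 'I_m -> S, q = \sum_i h i * g i.
Proof.
exists #|J|, (fun i => G (enum_val i)) => q; split=> [[h ->]|[h ->]].
  exists (fun i => h (enum_val i)).
  by rewrite (reindex (fun i : 'I_#|J| => enum_val i)) //; apply/onW_bij/enum_val_bij.
exists (fun j => h (enum_rank j)).
rewrite [RHS](reindex (fun i : 'I_#|J| => enum_val i)) /=.
  by apply: eq_bigr => i _; rewrite enum_valK.
exact/onW_bij/enum_val_bij.
Qed.
End IdealSpan.

Section PushoutPresentation.
Variables (k : fieldType) (C C' D : comPzRingType).
Variables (f : {rmorphism C -> C'}) (g : {rmorphism C -> D}).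
Variables (s : {rmorphism k -> C}) (s' : {rmorphism k -> C'}) (s'' : {rmorphism k -> D}).
Hypotheses (fs : forall c, f (s c) = s' c) (gs : forall c, g (s c) = s'' c).

(** Makes the overlaps of a flat cover objects of the category. The generators are those of C' and D
    together; the relations are theirs, plus one for each generator of C. *)
Lemma pushout_fp : finitely_presented s -> finitely_presented s' ->
  finitely_presented s'' ->
  finitely_presented (pushl f g \o s' : {rmorphism k -> pushout f g}).
Proof.
move=> [n0 [p0 [p0C p0s _]]] [n1 [p1 [p1C p1s [m1 [g1 g1P]]]]]
  [n2 [p2 [p2C p2s [m2 [g2 g2P]]]]].
have [r1 r1K] := choice p1s; have [r2 r2K] := choice p2s.
pose S : comPzRingType := {mpoly k[n1 + n2]}.
have [p [pC pX]] := @mpoly_eval k (n1 + n2) (pushout f g)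
  (pushl f g \o s' : {rmorphism k -> pushout f g})
  (fun i => match split i with inl j => pushl f g (p1 'X_j)
                          | inr j => pushr f g (p2 'X_j) end).
have [L [LC LX]] := @mpoly_eval k n1 S (@mpolyC (n1 + n2) k : {rmorphism k -> S})
  (fun j => 'X_(lshift n2 j)).
have [R [RC RX]] := @mpoly_eval k n2 S (@mpolyC (n1 + n2) k : {rmorphism k -> S})
  (fun j => 'X_(rshift n1 j)).
have pL a : p (L a) = pushl f g (p1 a).
  apply: (@mpoly_rmorphism_ext k n1 _ (p \o L) (pushl f g \o p1)) => [c|j] /=.
    by rewrite LC pC /= p1C.
  by rewrite LX pX (unsplitK (inl j)).
have pR a : p (R a) = pushr f g (p2 a).
  apply: (@mpoly_rmorphism_ext k n2 _ (p \o R) (pushr f g \o p2)) => [c|j] /=.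
    by rewrite RC pC /= p2C -gs -fs pushout_comm.
  by rewrite RX pX (unsplitK (inr j)).
(* The third family identifies the two images of each generator of C; [IC] below propagates this to
   every element of C. *)
pose G (j : 'I_m1 + 'I_m2 + 'I_n0) : S := match j with
  | inl (inl i) => L (g1 i) | inl (inr i) => R (g2 i)
  | inr i => L (r1 (f (p0 'X_i))) - R (r2 (g (p0 'X_i))) end.
pose I := ideal_span G.
have IL a : p1 a = 0 -> I (L a).
  move=> /g1P[h ->]; rewrite rmorph_sum; apply: big_ind => [||i _].
  - exact: ideal_span0.
  - exact: ideal_spanD.
  by rewrite rmorphM; apply: ideal_spanM; apply: (ideal_span_gen G (inl (inl i))).
have IR a : p2 a = 0 -> I (R a).
  move=> /g2P[h ->]; rewrite rmorph_sum; apply: big_ind => [||i _].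
  - exact: ideal_span0.
  - exact: ideal_spanD.
  by rewrite rmorphM; apply: ideal_spanM; apply: (ideal_span_gen G (inl (inr i))).
have ILe a b : p1 a = p1 b -> I (L a - L b).
  by move=> ab; rewrite -rmorphB; apply: IL; rewrite rmorphB ab subrr.
have IRe a b : p2 a = p2 b -> I (R a - R b).
  by move=> ab; rewrite -rmorphB; apply: IR; rewrite rmorphB ab subrr.
have IC c : I (L (r1 (f c)) - R (r2 (g c))).
  have [q <-] := p0s c; elim/mpoly_gen_ind: q => [d|i|a b Ia Ib|a b Ia Ib].
  - apply: (ideal_span_trans (b := L d%:MP)).
      by apply: ILe; rewrite r1K p0C fs p1C.
    apply: (ideal_span_trans (b := R d%:MP)).
      by rewrite LC RC subrr; apply: ideal_span0.
    by apply: IRe; rewrite r2K p0C gs p2C.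
  - exact: (ideal_span_gen G (inr i)).
  - apply: (ideal_span_trans (b := L (r1 (f (p0 a))) + L (r1 (f (p0 b))))).
      by rewrite -rmorphD; apply: ILe; rewrite !rmorphD !r1K.
    apply: (ideal_span_trans (b := R (r2 (g (p0 a))) + R (r2 (g (p0 b))))).
      by rewrite opprD addrACA; apply: ideal_spanD.
    by rewrite -rmorphD; apply: IRe; rewrite !rmorphD !r2K.
  - apply: (ideal_span_trans (b := L (r1 (f (p0 a))) * L (r1 (f (p0 b))))).
      by rewrite -rmorphM; apply: ILe; rewrite !rmorphM !r1K.
    apply: (ideal_span_trans (b := R (r2 (g (p0 a))) * R (r2 (g (p0 b))))).
      exact: ideal_span_congrM.
    by rewrite -rmorphM; apply: IRe; rewrite !rmorphM !r2K.
(* An inverse of [p] modulo the ideal, defined on formal sums. The sections [r1] and [r2] are mere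
   functions, so [Phi] respects the tensor relations only modulo the ideal. *)
pose Phi (t : seq (C' * D)) : S := \sum_(c <- t) L (r1 c.1) * R (r2 c.2).
have PhiP t u : @tensor_rel C (alg_module (alg_of_rmorphism f))
    (alg_module (alg_of_rmorphism g)) t u -> I (Phi t - Phi u).
  elim=> {t u}.
  - by move=> t; rewrite subrr; apply: ideal_span0.
  - by move=> t u _; apply: ideal_span_sym.
  - by move=> t u v _ tu _; apply: ideal_span_trans.
  - move=> t t' u u' _ tt' _ uu'; rewrite /Phi !big_cat /= opprD addrACA.
    exact: ideal_spanD.
  - by move=> t u; rewrite /Phi !big_cat /= addrC subrr; apply: ideal_span0.
  - move=> d; rewrite /Phi big_seq1 big_nil subr0 mulrC; apply: ideal_spanM.
    by apply: IL; rewrite r1K.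
  - move=> c c' d; rewrite /Phi !big_cons !big_nil /= !addr0 -mulrDl -mulrBl mulrC.
    apply: ideal_spanM; rewrite -rmorphD; apply: ILe.
    by rewrite rmorphD !r1K.
  - move=> c d d'; rewrite /Phi !big_cons !big_nil /= !addr0 -mulrDr -mulrBr.
    apply: ideal_spanM; rewrite -rmorphD; apply: IRe.
    by rewrite rmorphD !r2K.
  - move=> e c d; rewrite /Phi !big_seq1 /=.
    apply: (ideal_span_trans (b := L (r1 (f e)) * L (r1 c) * R (r2 d))).
      apply: ideal_span_congrM; last by rewrite subrr; apply: ideal_span0.
      by rewrite -rmorphM; apply: ILe; rewrite rmorphM !r1K.
    rewrite (mulrC (L _)) -mulrA; apply: ideal_span_congrM.
      by rewrite subrr; apply: ideal_span0.
    apply: (ideal_span_trans (b := R (r2 (g e)) * R (r2 d))).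
      apply: ideal_span_congrM; first exact: IC.
      by rewrite subrr; apply: ideal_span0.
    by rewrite -rmorphM; apply: IRe; rewrite rmorphM !r2K.
have LR q : exists t : seq ({mpoly k[n1]} * {mpoly k[n2]}),
    q = \sum_(c <- t) L c.1 * R c.2.
  elim/mpoly_gen_ind: q => [c|i|a b [t ->] [u ->]|a b [t ->] [u ->]].
  - by exists [:: (c%:MP, 1)]; rewrite big_seq1 rmorph1 mulr1 LC.
  - rewrite -(splitK i); case: (split i) => j /=.
      by exists [:: ('X_j, 1)]; rewrite big_seq1 rmorph1 mulr1 LX.
    by exists [:: (1, 'X_j)]; rewrite big_seq1 rmorph1 mul1r RX.
  - by exists (t ++ u); rewrite big_cat.
  - exists [seq (c.1 * d.1, c.2 * d.2) | c <- t, d <- u].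
    rewrite big_allpairs_dep mulr_suml; apply: eq_bigr => c _.
    by rewrite mulr_sumr; apply: eq_bigr => d _; rewrite /= !rmorphM mulrACA.
have [m [G' GP]] := ideal_span_ord G.
exists (n1 + n2)%N, p; split=> //.
- elim/pushout_ind => [|c d t [q <-]]; first by exists 0; rewrite rmorph0.
  exists (L (r1 c) * R (r2 d) + q); rewrite rmorphD rmorphM pL pR r1K r2K.
  by rewrite -ppureE.
- exists m, G' => q; rewrite -GP; split=> [q0|[h ->]]; last first.
    rewrite rmorph_sum big1 // => j _; rewrite rmorphM.
    suff -> : p (G j) = 0 by rewrite mulr0.
    case: j => [[i|i]|i]; rewrite /G.
    + rewrite pL (_ : p1 _ = 0) ?rmorph0 //; apply/g1P.
      exact: ideal_span_gen.
    + rewrite pR (_ : p2 _ = 0) ?rmorph0 //; apply/g2P.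
      exact: ideal_span_gen.
    + by rewrite rmorphB pL pR r1K r2K pushout_comm subrr.
  (* If p(q) = 0, the formal sum attached to q represents the zero tensor, so its [Phi] lies in the
     ideal; and q is congruent to that [Phi]. *)
  have [t qE] := LR q.
  have : I (Phi [seq (p1 c.1, p2 c.2) | c <- t] - Phi [::]).
    apply: PhiP; apply/tsumP; rewrite /= !tsumE big_nil big_map.
    rewrite -[RHS]q0 qE rmorph_sum; apply: eq_bigr => c _.
    by rewrite rmorphM pL pR -ppureE.
  rewrite /Phi big_nil subr0 big_map => Iq.
  rewrite -(subr0 q); apply: ideal_span_trans; last first.
    by rewrite subr0; exact: Iq.
  rewrite qE -sumrB; apply: big_ind => [||c _].
  - exact: ideal_span0.
  - exact: ideal_spanD.
  by apply: ideal_span_congrM; [apply: ILe|apply: IRe]; rewrite ?r1K ?r2K.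
Qed.
End PushoutPresentation.

(** * Faithfully flat descent *)

Section TensorModule.
Variables (C : comPzRingType) (M N : lmodType C).

Let scale_fun (c : C) (m : M) (n : N) : tensor M N := tpure (c *: m) n.

Fact tensor_scale_bal c : balanced (scale_fun c).
Proof.
split=> [m m' n|m n n'|d m n]; rewrite /scale_fun.
- by rewrite scalerDr tpureDl.
- by rewrite tpureDr.
- by rewrite scalerA mulrC -scalerA tpureZ.
Qed.

Definition tensor_scale (c : C) (t : tensor M N) : tensor M N :=
  tlift (scale_fun c) t.

Lemma tensor_scaleE c m n : tensor_scale c (tpure m n) = tpure (c *: m) n.
Proof. exact: (tliftE (tensor_scale_bal c)). Qed.

Fact tensor_scaleDr : right_distributive tensor_scale +%R.
Proof. by move=> c; apply: (tliftD (tensor_scale_bal c)). Qed.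

Fact tensor_scale0 c : tensor_scale c 0 = 0.
Proof. exact: (tlift0 (tensor_scale_bal c)). Qed.

Fact tensor_scaleA a b t :
  tensor_scale a (tensor_scale b t) = tensor_scale (a * b) t.
Proof.
elim/tensor_ind: t => [|m n t IHt]; first by rewrite !tensor_scale0.
by rewrite !tensor_scaleDr IHt !tensor_scaleE scalerA.
Qed.

Fact tensor_scale1 : left_id 1 tensor_scale.
Proof.
elim/tensor_ind => [|m n t IHt]; first by rewrite tensor_scale0.
by rewrite tensor_scaleDr IHt tensor_scaleE scale1r.
Qed.

Fact tensor_scaleDl t : {morph tensor_scale^~ t : a b / a + b}.
Proof.
move=> a b; elim/tensor_ind: t => [|m n t IHt]; first by rewrite !tensor_scale0 addr0.
by rewrite !tensor_scaleDr IHt !tensor_scaleE scalerDl tpureDl addrACA.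
Qed.

HB.instance Definition _ := GRing.Zmodule_isLmodule.Build C (tensor M N)
  tensor_scaleA tensor_scale1 tensor_scaleDr tensor_scaleDl.

Lemma tpure_scalel c m n : c *: tpure m n = tpure (c *: m) n.
Proof. exact: tensor_scaleE. Qed.

Lemma tpure_scaler c m n : c *: tpure m n = tpure m (c *: n).
Proof. by rewrite tpure_scalel tpureZ. Qed.

Lemma tpure_bal : balanced (@tpure C M N).
Proof.
by split=> [m m' n|m n n'|c m n]; [rewrite tpureDl|rewrite tpureDr|rewrite tpureZ].
Qed.
End TensorModule.

Section Balanced.
Variables (C : comPzRingType) (M N : lmodType C) (G : zmodType) (f : M -> N -> G).
Hypothesis fb : balanced f.

Lemma balanced0l n : f 0 n = 0.
Proof. by case: fb => fDl _ _; apply: (addrI (f 0 n)); rewrite -fDl !addr0. Qed.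

Lemma balanced0r m : f m 0 = 0.
Proof. by case: fb => _ fDr _; apply: (addrI (f m 0)); rewrite -fDr !addr0. Qed.

Lemma balanced_suml (J : Type) (s : seq J) (F : J -> M) n :
  f (\sum_(j <- s) F j) n = \sum_(j <- s) f (F j) n.
Proof.
by case: fb => fDl _ _; apply: (big_morph (f^~ n)) => [x y|]; [apply: fDl|apply: balanced0l].
Qed.

Lemma balanced_sumr (J : Type) (s : seq J) (F : J -> N) m :
  f m (\sum_(j <- s) F j) = \sum_(j <- s) f m (F j).
Proof.
by case: fb => _ fDr _; apply: (big_morph (f m)) => [x y|]; [apply: fDr|apply: balanced0r].
Qed.
End Balanced.

Section TensorMap.
Variables (C : comPzRingType) (M N M' N' : lmodType C).
Variables (u : {linear M -> M'}) (v : {linear N -> N'}).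

Lemma tmap_bal : balanced (fun m n => tpure (u m) (v n)).
Proof.
split=> [m m' n|m n n'|c m n].
- by rewrite linearD tpureDl.
- by rewrite linearD tpureDr.
- by rewrite !linearZ_LR tpureZ.
Qed.

Lemma tmapE m n : tmap u v (tpure m n) = tpure (u m) (v n).
Proof. exact: (tliftE tmap_bal). Qed.

Lemma tmapD t t' : tmap u v (t + t') = tmap u v t + tmap u v t'.
Proof. exact: (tliftD tmap_bal). Qed.

Lemma tmap0 : tmap u v 0 = 0.
Proof. exact: (tlift0 tmap_bal). Qed.

Lemma tmap_sum (J : Type) (s : seq J) (F : J -> tensor M N) :
  tmap u v (\sum_(j <- s) F j) = \sum_(j <- s) tmap u v (F j).
Proof. by apply: big_morph; [apply: tmapD|apply: tmap0]. Qed.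

Lemma tmapZ c t : tmap u v (c *: t) = c *: tmap u v t.
Proof.
elim/tensor_ind: t => [|m n t IHt]; first by rewrite scaler0 tmap0 scaler0.
by rewrite scalerDr !tmapD scalerDr IHt tpure_scalel !tmapE linearZ_LR tpure_scalel.
Qed.
End TensorMap.

Section Descent.
Variables (C : comPzRingType) (E : lmodType C) (mul : E -> E -> E) (one : E).
Hypotheses (mulDl : forall a b e, mul (a + b) e = mul a e + mul b e)
  (mulDr : forall e a b, mul e (a + b) = mul e a + mul e b)
  (mulZl : forall c a b, mul (c *: a) b = c *: mul a b)
  (mulZr : forall c a b, mul a (c *: b) = c *: mul a b)
  (mul1e : forall e, mul one e = e).
Variable M : lmodType C.
Local Notation N := (tensor M E).

Definition descent_unit (m : M) : N := tpure m one.

Fact descent_unit_linear : linear descent_unit.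
Proof. by move=> c a b; rewrite /descent_unit tpureDl tpure_scalel. Qed.

HB.instance Definition _ := GRing.isLinear.Build C M N *:%R descent_unit
  descent_unit_linear.

(** The second differential of the Amitsur complex M -> M ⊗ E -> M ⊗ E ⊗ E: it sends m ⊗ e to m ⊗ e
    ⊗ 1 - m ⊗ 1 ⊗ e. E is a module with a bilinear product, since the product of the members of a
    cover is given as a [prod_module]. *)
Definition descent_diff (w : N) : tensor N E :=
  tpure w one - tmap descent_unit idfun w.

Fact descent_diff_linear : linear descent_diff.
Proof.
move=> c a b; rewrite /descent_diff tpureDl -tpure_scalel.
rewrite (tmapD _ (idfun : {linear E -> E})) (tmapZ _ (idfun : {linear E -> E})).
by rewrite opprD scalerBr addrACA.
Qed.

HB.instance Definition _ := GRing.isLinear.Build C N (tensor N E) *:%R descent_diff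
  descent_diff_linear.

Let mult_fun e' (m : M) (e : E) : N := tpure m (mul e e').

Fact mult_fun_bal e' : balanced (mult_fun e').
Proof.
rewrite /mult_fun; split=> [m m' n|m n n'|c m n].
- by rewrite tpureDl.
- by rewrite mulDl tpureDr.
- by rewrite mulZl tpureZ.
Qed.

Let mult (w : N) (e' : E) : N := tlift (mult_fun e') w.

Fact multE m e e' : mult (tpure m e) e' = tpure m (mul e e').
Proof. exact: (tliftE (mult_fun_bal e')). Qed.

Fact multD w w' e : mult (w + w') e = mult w e + mult w' e.
Proof. exact: (tliftD (mult_fun_bal e)). Qed.

Fact mult0 e : mult 0 e = 0.
Proof. exact: (tlift0 (mult_fun_bal e)). Qed.

Fact mult_bal : balanced mult.
Proof.
split=> [w w' e|w e e'|c w e]; first exact: multD.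
  elim/tensor_ind: w => [|m n t IHt]; first by rewrite !mult0 addr0.
  by rewrite !multD IHt !multE mulDr tpureDr addrACA.
elim/tensor_ind: w => [|m n t IHt]; first by rewrite scaler0 !mult0.
by rewrite scalerDr !multD IHt tpure_scaler !multE mulZr mulZl.
Qed.

Let contract_fun e' (w : N) (e : E) : tensor N E := tpure w (mul e e').

Fact contract_fun_bal e' : balanced (contract_fun e').
Proof.
rewrite /contract_fun; split=> [m m' n|m n n'|c m n].
- by rewrite tpureDl.
- by rewrite mulDl tpureDr.
- by rewrite mulZl tpureZ.
Qed.

Let contract (w : tensor N E) (e' : E) : tensor N E := tlift (contract_fun e') w.

Fact contractE m e e' : contract (tpure m e) e' = tpure m (mul e e').
Proof. exact: (tliftE (contract_fun_bal e')). Qed.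

Fact contractD w w' e : contract (w + w') e = contract w e + contract w' e.
Proof. exact: (tliftD (contract_fun_bal e)). Qed.

Fact contract0 e : contract 0 e = 0.
Proof. exact: (tlift0 (contract_fun_bal e)). Qed.

Fact contract_bal : balanced contract.
Proof.
split=> [w w' e|w e e'|c w e]; first exact: contractD.
  elim/tensor_ind: w => [|m n t IHt]; first by rewrite !contract0 addr0.
  by rewrite !contractD IHt !contractE mulDr tpureDr addrACA.
elim/tensor_ind: w => [|m n t IHt]; first by rewrite scaler0 !contract0.
by rewrite scalerDr !contractD IHt tpure_scaler !contractE mulZr mulZl.
Qed.

Let id_E : {linear E -> E} := idfun.

Hypothesis ffE : faithfully_flat E.

(* After tensoring with E, multiplication E ⊗ E -> E provides a contracting
   homotopy. *)
Lemma descent_exact : exact_at descent_unit descent_diff.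
Proof.
apply/ffE => W; split=> [W0|[X <-]]; last first.
  elim/tensor_ind: X => [|m e t IHt].
    by rewrite (tmap0 descent_unit id_E) (tmap0 descent_diff id_E).
  rewrite (tmapD descent_unit id_E) (tmapD descent_diff id_E) IHt addr0.
  rewrite (tmapE descent_unit id_E) (tmapE descent_diff id_E).
  suff e0 : descent_diff (descent_unit m) = 0.
    by rewrite [X in tpure X _]e0 (balanced0l (tpure_bal _ _)).
  by rewrite /descent_diff [tmap _ _ _](tmapE descent_unit id_E) subrr.
exists (tlift mult W).
(* The homotopy identity. When the left side vanishes, it exhibits W as the image of its contraction
   by [mult]. *)
suff : tlift contract (tmap descent_diff id_E W) =
    W - tmap descent_unit id_E (tlift mult W).
  by rewrite W0 (tlift0 contract_bal) => /esym/eqP; rewrite subr_eq0 => /eqP<-.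
elim/tensor_ind: W {W0} => [|w e W IHW].
  by rewrite (tmap0 descent_diff id_E) (tlift0 contract_bal) (tlift0 mult_bal)
    (tmap0 descent_unit id_E) subrr.
rewrite (tmapD descent_diff id_E) (tliftD contract_bal) IHW (tliftD mult_bal).
rewrite (tmapD descent_unit id_E) opprD addrACA; congr (_ + _) => {W IHW}.
rewrite (tmapE descent_diff id_E) (tliftE contract_bal) (tliftE mult_bal) /=.
rewrite /descent_diff contractD contractE mul1e; congr (_ + _).
elim/tensor_ind: w => [|m e' w IHw].
  by rewrite (tmap0 descent_unit id_E) mult0 (tmap0 descent_unit id_E) oppr0 contract0.
rewrite (tmapD descent_unit id_E) multD (tmapD descent_unit id_E) !opprD contractD IHw.
congr (_ + _); rewrite multE !(tmapE descent_unit id_E).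
apply: (addrI (contract (tpure (descent_unit m) e') e)).
by rewrite -contractD subrr contract0 contractE subrr.
Qed.

(** Injectivity is exactness of 0 -> M -> M ⊗ E, so it can be tested after tensoring with E, where m
    ⊗ e |-> m ⊗ 1 ⊗ e is retracted by the multiplication of E. *)
Lemma descent_unit_inj : injective descent_unit.
Proof.
suff ex0 : exact_at (\0 : M -> M) descent_unit.
  move=> a b ab; apply/eqP; rewrite -subr_eq0; apply/eqP.
  have e0 : descent_unit (a - b) = 0 by rewrite linearB /= ab subrr.
  by have [x <-] := (ex0 _).1 e0.
pose z : {linear M -> M} := \0.
apply/(ffE z descent_unit) => X.
have z0 X' : tmap z id_E X' = 0.
  elim/tensor_ind: X' => [|m e t IHt]; first by rewrite tmap0.
  by rewrite tmapD IHt tmapE (balanced0l (tpure_bal _ _)) addr0.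
have mK X' : tlift mult (tmap descent_unit id_E X') = X'.
  elim/tensor_ind: X' => [|m e t IHt].
    by rewrite (tmap0 descent_unit id_E) (tlift0 mult_bal).
  rewrite (tmapD descent_unit id_E) (tliftD mult_bal) IHt.
  by rewrite (tmapE descent_unit id_E) (tliftE mult_bal) multE mul1e.
split=> [X0|[Y <-]].
  by exists 0; rewrite z0 -(mK X) X0 (tlift0 mult_bal).
by rewrite z0 (tmap0 descent_unit id_E).
Qed.
End Descent.

(** * The flat topology is subcanonical *)

Section CommalgPushout.
Variables (k : fieldType) (C C' D : commalg_cat k) (f : hom C C') (g : hom C D).

Lemma commalg_str_hom (X Y : commalg_cat k) (h : hom X Y) c :
  commalg_rmorphism h (commalg_str X c) = commalg_str Y c.
Proof. exact: (alghom_str h). Qed.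

Definition commalg_pushout : commalg_cat k :=
  @CommAlg k (pushout (commalg_rmorphism f) (commalg_rmorphism g)) _
    (pushout_fp (commalg_str_hom f) (commalg_str_hom g)
       (commalg_fp C) (commalg_fp C') (commalg_fp D)).

Definition pushl_hom : hom C' commalg_pushout.
Proof.
by exists (pushl (commalg_rmorphism f) (commalg_rmorphism g)
  : {rmorphism commalg_sort C' -> commalg_sort commalg_pushout}).
Defined.

Definition pushr_hom : hom D commalg_pushout.
Proof.
exists (pushr (commalg_rmorphism f) (commalg_rmorphism g)
  : {rmorphism commalg_sort D -> commalg_sort commalg_pushout}) => c.
rewrite /= -(commalg_str_hom g) -(commalg_str_hom f).
by rewrite pushout_comm.
Defined.

Lemma pushout_hom_comm : comp pushl_hom f = comp pushr_hom g.
Proof. by apply: alghom_ext => c /=; apply: pushout_comm. Qed.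

Variables (E : commalg_cat k) (u : hom C' E) (v : hom D E).
Hypothesis uv : comp u f = comp v g.

Fact copair_hom_subproof c :
  commalg_rmorphism u (commalg_rmorphism f c) =
  commalg_rmorphism v (commalg_rmorphism g c).
Proof. exact: (congr1 (fun h : hom C E => commalg_rmorphism h c) uv). Qed.

Definition copair_hom : hom commalg_pushout E.
Proof.
exists (copair_rmorphism copair_hom_subproof) => c.
rewrite /= (copairE copair_hom_subproof) rmorph1 mulr1.
exact: commalg_str_hom.
Defined.

Lemma copair_homE c d : commalg_rmorphism copair_hom (ppure _ _ c d) =
  commalg_rmorphism u c * commalg_rmorphism v d.
Proof. exact: (copairE copair_hom_subproof). Qed.

Lemma copair_pushl : comp copair_hom pushl_hom = u.
Proof.
apply: alghom_ext => c; apply: etrans (copair_homE _ _) _.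
by rewrite rmorph1 mulr1.
Qed.
End CommalgPushout.

Lemma pull_sieve_comp (X : category) (A B D : X) (f : hom A B) (g : hom B D)
    (S : hom_family A) :
  pull_sieve g (pull_sieve f S) = pull_sieve (comp g f) S.
Proof.
apply: functional_extensionality_dep => E; apply: functional_extensionality_dep => h.
by rewrite /pull_sieve compA.
Qed.

Lemma is_sieve_pull (X : category) (A B : X) (f : hom A B) (S : hom_family A) :
  is_sieve S -> is_sieve (pull_sieve f S).
Proof. by move=> sS D E g h Sg; rewrite /pull_sieve -compA; apply: sS. Qed.

Section StructureTopology.
Variable k : fieldType.
Local Notation "h @@ c" := (commalg_rmorphism h c) (at level 40).

Lemma commalg_compE (C D E : commalg_cat k) (g : hom D E) (h : hom C D) c :
  comp g h @@ c = g @@ (h @@ c).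
Proof. by []. Qed.

(** Families are total functions constrained only on S, so that no value depends on a proof of
    membership. *)
Definition ring_matching (C : commalg_cat k) (S : hom_family C)
    (y : forall D : commalg_cat k, hom C D -> commalg_sort D) :=
  forall (D E : commalg_cat k) (h : hom C D) (g : hom D E),
    S D h -> g @@ (y D h) = y E (comp g h).

Definition ring_effective (C : commalg_cat k) (S : hom_family C) :=
  (forall y, ring_matching S y ->
     exists c, forall (D : commalg_cat k) (h : hom C D), S D h -> h @@ c = y D h)
  /\ (forall c c' : commalg_sort C,
       (forall (D : commalg_cat k) (h : hom C D), S D h -> h @@ c = h @@ c') ->
       c = c').

(* The finest topology for which the tautological presheaf D |-> D is a sheaf. *)
Definition ring_topology : covering (commalg_cat k) := fun C S =>
  is_sieve S /\ forall (C' : commalg_cat k) (f : hom C C'),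
    ring_effective (pull_sieve f S).

Lemma ring_topology_eff (C : commalg_cat k) (S : hom_family C) :
  ring_topology S -> ring_effective S.
Proof.
move=> [_ /(_ C (idm C))]; rewrite (_ : pull_sieve _ _ = S) //.
apply: functional_extensionality_dep => E; apply: functional_extensionality_dep => h.
by rewrite /pull_sieve comp_idr.
Qed.

Lemma ring_topology_pull (C C' : commalg_cat k) (f : hom C C') (S : hom_family C) :
  ring_topology S -> ring_topology (pull_sieve f S).
Proof.
move=> [sS effS]; split; first exact: is_sieve_pull.
by move=> D g; rewrite pull_sieve_comp; apply: effS.
Qed.

(** Gluing happens twice: along each g in S the family glues over the pullback of T, and the
    resulting elements match by separatedness over T, so they glue over S. Whether the result has
    the prescribed value on T is tested again over S. *)
Lemma ring_topology_trans (C : commalg_cat k) (S T : hom_family C) :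
  ring_topology S -> is_sieve T ->
  (forall (B : commalg_cat k) (f : hom C B), S B f -> ring_topology (pull_sieve f T)) ->
  ring_topology T.
Proof.
move=> topS sT ST; split=> // C' f.
have {topS} topS := ring_topology_pull f topS.
have {}ST (B : commalg_cat k) (g : hom C' B) : pull_sieve f S g ->
    ring_effective (pull_sieve g (pull_sieve f T)).
  by move=> Sg; rewrite pull_sieve_comp; apply/ring_topology_eff/ST.
have {}sT : is_sieve (pull_sieve f T) by apply: is_sieve_pull.
move: (pull_sieve f S) (pull_sieve f T) topS ST sT => {}S {}T topS ST sT.
have [effS injS] := ring_topology_eff topS.
split=> [y ymatch|c c' cc']; last first.
  apply: injS => D h Sh; apply: (ST D h Sh).2 => E g Tgh.
  by rewrite -!commalg_compE; apply: cc'.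
(* The value 0 off S is a default that makes the family total. *)
have loc (D : commalg_cat k) (g : hom C' D) : exists d : commalg_sort D, S D g ->
    forall (E : commalg_cat k) (h : hom D E), T E (comp h g) -> h @@ d = y E (comp h g).
  have [Sg|nSg] := pselect (S D g); last by exists 0.
  have [d dP] := (ST D g Sg).1 (fun E h => y E (comp h g)) (fun E G h e Th =>
    etrans (ymatch E G (comp h g) e Th) (congr1 (y G) (compA e h g))).
  by exists d => _ E h; apply: dP.
pose d D g := projT1 (cid (loc D g)).
have dP D g : S D g ->
    forall (E : commalg_cat k) (h : hom D E), T E (comp h g) -> h @@ d D g = y E (comp h g).
  by rewrite /d; case: cid.
have [c cP] : exists c, forall (D : commalg_cat k) (h : hom C' D), S D h -> h @@ c = d D h.
  apply: effS => D E h g Sh; have Sgh := topS.1 _ _ _ g Sh.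
  apply: (ST E _ Sgh).2 => G e Te; rewrite -commalg_compE (dP E _ Sgh) //.
  by rewrite (dP D h Sh) -?compA.
exists c => D g Tg.
apply: (ring_topology_eff (ring_topology_pull g topS)).2 => E h Sh.
rewrite -commalg_compE cP // ymatch //.
have Th := sT _ _ _ h Tg.
have := dP E (comp h g) Sh E (idm E); rewrite comp_idl => <- //.
Qed.

Lemma ring_topology_topology : grothendieck_topology ring_topology.
Proof.
split.
- by move=> C S [].
- move=> C; split=> // C' f; split=> [y ymatch|c c' cc']; last exact: (cc' C' (idm C')).
  by exists (y C' (idm C')) => D h _; rewrite ymatch // comp_idr.
- by move=> C C' f S; apply: ring_topology_pull.
- exact: ring_topology_trans.
Qed.

(** * Effectiveness of flat covers *)

Section FlatCover.
Variables (C : commalg_cat k) (n : nat) (D : 'I_n -> commalg_cat k).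
Variable (u : forall i, hom C (D i)).
Let Dm i := alg_module (alg_of_rmorphism (commalg_rmorphism (u i))).
Let E : lmodType C := prod_module Dm.
Hypothesis ffE : faithfully_flat E.
Variables (C' : commalg_cat k) (t : hom C C').
Let M : lmodType C := alg_module (alg_of_rmorphism (commalg_rmorphism t)).

Let mulE (e e' : E) : E := fun i => (e i : D i) * (e' i : D i).
Let oneE : E := fun i => (1 : D i).

Let inj_fun i (d : Dm i) : E := dfwith (fun j => 0 : Dm j) d.

Fact inj_fun_in i d : inj_fun d i = d.
Proof. exact: dfwith_in. Qed.

Fact inj_fun_out i j d : i != j -> @inj_fun i d j = 0.
Proof. exact: dfwith_out. Qed.

Fact inj_linear i : linear (@inj_fun i).
Proof.
move=> c a b; apply: functional_extensionality_dep => j.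
rewrite -[RHS]/(c *: inj_fun a j + inj_fun b j).
have [<-|ij] := eqVneq i j; first by rewrite !inj_fun_in.
by rewrite !inj_fun_out // scaler0 addr0.
Qed.

Let inj i : {linear Dm i -> E} :=
  HB.pack (@inj_fun i) (GRing.isLinear.Build C (Dm i) E *:%R _ (@inj_linear i)).

Let proj_fun i (e : E) : Dm i := e i.

Fact proj_linear i : linear (@proj_fun i).
Proof. by []. Qed.

Let proj i : {linear E -> Dm i} :=
  HB.pack (@proj_fun i) (GRing.isLinear.Build C E (Dm i) *:%R _ (@proj_linear i)).

Fact prod_sumE (J : Type) (s : seq J) (F : J -> E) i :
  (\sum_(j <- s) F j) i = \sum_(j <- s) F j i.
Proof. by apply: (big_morph (@^~ i)). Qed.

Fact sum_inj (e : E) : \sum_i inj i (e i) = e.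
Proof.
apply: functional_extensionality_dep => j; rewrite prod_sumE (bigD1 j) //=.
rewrite inj_fun_in big1 ?addr0 // => i ij; exact: inj_fun_out.
Qed.

Let Ei i := commalg_pushout t (u i).
Let Ml i : hom C' (Ei i) := pushl_hom t (u i).
Let idM : {linear M -> M} := idfun.

(* By conversion, the pushout Ei i is the tensor product of the modules M and D_i. *)
Let incl i (z : commalg_sort (Ei i)) : tensor M E := tmap idM (inj i) z.

Fact inclE i m d : incl (i := i) (ppure _ _ m d) = tpure (m : M) (inj i d).
Proof. exact: (tmapE idM (inj i)). Qed.

Fact inclD i z z' : incl (i := i) (z + z') = incl z + incl z'.
Proof. exact: (tmapD idM (inj i)). Qed.

Fact incl0 i : incl (i := i) 0 = 0.
Proof. exact: (tmap0 idM (inj i)). Qed.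

Fact inclZ i c z : incl (i := i) (Ml i @@ (t @@ c) * z) = c *: incl z.
Proof.
elim/pushout_ind: z => [|m d z IHz]; first by rewrite mulr0 incl0 scaler0.
rewrite mulrDr !inclD scalerDr IHz; congr (_ + _).
by rewrite -[Ml i @@ _]/(ppure _ _ _ 1) ppureM mul1r !inclE tpure_scalel.
Qed.

(** The triple product C' ⊗ D_i ⊗ D_j, bracketed like the (i, j) component of M ⊗ E ⊗ E. *)
Let Fij i j := commalg_pushout (comp (Ml i) t) (u j).

Fact Fij_comm i j : comp (comp (pushl_hom (comp (Ml i) t) (u j)) (Ml i)) t =
  comp (pushr_hom (comp (Ml i) t) (u j)) (u j).
Proof. by rewrite -compA; apply: pushout_hom_comm. Qed.

(** Sends m ⊗ d to m ⊗ 1 ⊗ d; its counterpart m ⊗ d |-> m ⊗ d ⊗ 1 on [Ei i] is the left inclusion of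
    the pushout. *)
Let Fr i j : hom (Ei j) (Fij i j) := copair_hom (Fij_comm i j).

Let phi_fun i j (z : commalg_sort (Ei i)) (d : Dm j) : tensor (tensor M E) E :=
  tpure (incl z) (inj j d).

Fact phi_bal i j : @abalanced C (alg_of_rmorphism (commalg_rmorphism (comp (Ml i) t)))
  (alg_of_rmorphism (commalg_rmorphism (u j))) _ (@phi_fun i j).
Proof.
rewrite /phi_fun; split=> [a a' b|a b b'|c a b].
- by rewrite inclD tpureDl.
- by rewrite linearD tpureDr.
- by rewrite [incl _](inclZ c a) tpureZ -linearZ_LR.
Qed.

Let phi i j (z : commalg_sort (Fij i j)) : tensor (tensor M E) E :=
  @alift C (alg_of_rmorphism (commalg_rmorphism (comp (Ml i) t)))
    (alg_of_rmorphism (commalg_rmorphism (u j))) _ (@phi_fun i j) z.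

Fact phiE i j z d : phi (i := i) (j := j) (ppure _ _ z d) = tpure (incl z) (inj j d).
Proof. exact: (aliftE (phi_bal i j)). Qed.

Fact phiD i j z z' : phi (i := i) (j := j) (z + z') = phi z + phi z'.
Proof. exact: (aliftD (phi_bal i j)). Qed.

Fact phi0 i j : phi (i := i) (j := j) 0 = 0.
Proof. exact: (alift0 (phi_bal i j)). Qed.

Let id_E : {linear E -> E} := idfun.
Let d0 : {linear M -> tensor M E} := @descent_unit C E oneE M.

(** The unit of E is the sum of the units of the D_i, so inserting it in the middle slot splits into
    the maps [Fr i j]. *)
Fact phi_Fr j (z : commalg_sort (Ei j)) :
  \sum_i phi (Fr i j @@ z) = tmap d0 id_E (incl z).
Proof.
elim/pushout_ind: z => [|m d z IHz].
  rewrite incl0 tmap0 big1 // => i _; rewrite rmorph0; exact: phi0.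
rewrite inclD tmapD -IHz.
have -> : tmap d0 id_E (incl (i := j) (ppure _ _ m d)) =
    \sum_i tpure (tpure (m : M) (inj i 1)) (inj j d).
  rewrite inclE tmapE /= /descent_unit -[oneE]sum_inj.
  by rewrite (balanced_sumr (tpure_bal _ _)) (balanced_suml (tpure_bal _ _)).
rewrite -big_split; apply: eq_bigr => i _.
rewrite [Fr i j @@ _](rmorphD (commalg_rmorphism (Fr i j))) phiD; congr (_ + _).
rewrite copair_homE.
rewrite -[X in phi X](ppureE (commalg_rmorphism (comp (Ml i) t)) (commalg_rmorphism (u j))
   (Ml i @@ m) d).
by rewrite phiE inclE.
Qed.

(** The values on the C' ⊗ D_i add up to an element of M ⊗ E, and matching over the C' ⊗ D_i ⊗ D_j
    says that [descent_diff] kills it. Descent over C is applied to C' viewed as a C-module, which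
    settles the pulled back sieve without base changing the cover. *)
Lemma flat_cover_effective : ring_effective (pull_sieve t (sieve_of_cover u)).
Proof.
have mulDl a b e : mulE (a + b) e = mulE a e + mulE b e.
  by apply: functional_extensionality_dep => i; apply: mulrDl.
have mulDr e a b : mulE e (a + b) = mulE e a + mulE e b.
  by apply: functional_extensionality_dep => i; apply: mulrDr.
have mulZl c a b : mulE (c *: a) b = c *: mulE a b.
  by apply: functional_extensionality_dep => i; rewrite /mulE -[LHS]mulrA.
have mulZr c a b : mulE a (c *: b) = c *: mulE a b.
  by apply: functional_extensionality_dep => i; apply: mulrCA.
have mul1e e : mulE oneE e = e.
  by apply: functional_extensionality_dep => i; apply: mul1r.
have d0inj := @descent_unit_inj _ _ _ _ mulDl mulDr mulZl mulZr mul1e M ffE.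
have dex := @descent_exact _ _ _ _ mulDl mulDr mulZl mulZr mul1e M ffE.
have coverE i : pull_sieve t (sieve_of_cover u) (Ml i).
  by exists i, (pushr_hom t (u i)); apply: pushout_hom_comm.
have d0E (m : commalg_sort C') : d0 m = \sum_i incl (Ml i @@ m).
  rewrite -[LHS]/(tpure (m : M) oneE) -[oneE]sum_inj (balanced_sumr (tpure_bal _ _)).
  by apply: eq_bigr => i _; rewrite -[Ml i @@ m]/(ppure _ _ m 1) inclE.
split=> [y ymatch|c c' cc']; last first.
  apply: d0inj; rewrite [LHS]d0E [RHS]d0E; apply: eq_bigr => i _.
  by rewrite cc'.
pose yi i := y (Ei i) (Ml i).
pose Y := \sum_i incl (yi i).
have Y0 : descent_diff oneE Y = 0.
  rewrite /descent_diff; apply/eqP; rewrite subr_eq0; apply/eqP.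
  rewrite {2}/Y (tmap_sum d0 id_E).
  transitivity (\sum_j \sum_i phi (Fr i j @@ yi j)).
    rewrite -[oneE]sum_inj (balanced_sumr (tpure_bal _ _)); apply: eq_bigr => j _.
    rewrite (balanced_suml (tpure_bal _ _)); apply: eq_bigr => i _.
    rewrite /yi ymatch // copair_pushl -ymatch //.
    by rewrite -[X in phi X]/(ppure _ _ (y (Ei i) (Ml i)) 1) phiE.
  by apply: eq_bigr => j _; rewrite phi_Fr.
have [c cY] := (dex Y).1 Y0.
exists c => G h [i [g hg]].
(* Every member of the pulled back sieve factors through some C' ⊗ D_i, so it suffices to compare
   values there. *)
have w1 : comp (copair_hom hg) (Ml i) = h by apply: copair_pushl.
rewrite -w1 -ymatch; last exact: coverE.
rewrite commalg_compE; congr (_ @@ _).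
have prE (z : commalg_sort (Ei i)) : tmap idM (proj i) (incl z) = z.
  elim/pushout_ind: z => [|m d z IHz]; first by rewrite incl0 (tmap0 idM (proj i)).
  rewrite inclD (tmapD idM (proj i)) IHz inclE (tmapE idM (proj i)).
  by rewrite -[proj i _]/(inj_fun d i) inj_fun_in.
have pr0 j (z : commalg_sort (Ei j)) : j != i -> tmap idM (proj i) (incl z) = 0.
  move=> ji; elim/pushout_ind: z => [|m d z IHz].
    by rewrite incl0 (tmap0 idM (proj i)).
  rewrite inclD (tmapD idM (proj i)) IHz inclE (tmapE idM (proj i)).
  rewrite -[proj i _]/(inj_fun d i) inj_fun_out // addr0.
  exact: (balanced0r (tpure_bal _ _)).
transitivity (tmap idM (proj i) Y).
  by rewrite -cY [RHS](tmapE idM (proj i)).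
rewrite /Y (tmap_sum idM (proj i)) (bigD1 i) //= big1 ?addr0 => [|j ji]; first exact: prE.
exact: pr0.
Qed.
End FlatCover.

(** The generated topology is the intersection of all topologies containing the flat covers, so it
    suffices that [ring_topology] is one of them; the covering sieves themselves need no
    description. *)
Lemma flat_topology_ring_topology : coarser (@flat_topology k) ring_topology.
Proof.
move=> C S /(_ ring_topology); apply; first exact: ring_topology_topology.
move=> _ _ [C' n D u ffE]; split=> [B E f g [i [h ->]]|C'' t].
  by exists i, (comp g h); rewrite compA.
exact: flat_cover_effective.
Qed.
End StructureTopology.

(** * Amalgamation over a common subalgebra *)

Section Coefficients.
Variables (C D : comPzRingType) (A : algebra C) (B : algebra D) (F : frame A).
Variables (f : C -> D) (h : {rmorphism A -> B}).
Hypothesis hf : forall c, h (alg_str A c) = alg_str B (f c).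

(* B is the tensor product over C of A and the centralizer of h(A); b has
   coefficients [coef i b] with respect to the basis [h (frame_e F i)]. *)
Definition coef (i : frame_idx F) (b : B) : B :=
  \sum_(p <- frame_t F i) h p.1 * b * h p.2.

Lemma coef_bal b : abalanced (fun p q : A => h p * b * h q).
Proof.
split=> [a a' q|a q q'|c a q].
- by rewrite rmorphD !mulrDl.
- by rewrite rmorphD mulrDr.
- by rewrite !rmorphM hf [RHS]mulrA -[X in _ = X * _]alg_strC !mulrA.
Qed.

Lemma coefD i a b : coef i (a + b) = coef i a + coef i b.
Proof.
by rewrite /coef -big_split; apply: eq_bigr => p _; rewrite mulrDr mulrDl.
Qed.

Lemma coef0 i : coef i 0 = 0.
Proof. by rewrite /coef big1 // => p _; rewrite mulr0 mul0r. Qed.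

Lemma coef_sum i (J : Type) (s : seq J) (G : J -> B) :
  coef i (\sum_(j <- s) G j) = \sum_(j <- s) coef i (G j).
Proof. by apply: big_morph; [apply: coefD|apply: coef0]. Qed.

Lemma coefZ i d b : coef i (alg_str B d * b) = alg_str B d * coef i b.
Proof.
rewrite /coef mulr_sumr; apply: eq_bigr => p _.
by rewrite !mulrA alg_strC.
Qed.

Lemma coef_comm i x b : h x * coef i b = coef i b * h x.
Proof.
rewrite /coef mulr_sumr mulr_suml.
transitivity (\sum_(p <- frame_t F i) h (x * p.1) * b * h p.2).
  by apply: eq_bigr => p _; rewrite rmorphM !mulrA.
rewrite (frame_central (coef_bal b)).
by apply: eq_bigr => p _; rewrite rmorphM !mulrA.
Qed.

(** This is [frame_unit] for the balanced map (p, q) |-> h(p) b h(q), whose value at (1, 1) is b. *)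
Lemma coef_basis b : \sum_i h (frame_e F i) * coef i b = b.
Proof.
transitivity (h 1 * b * h 1); last by rewrite rmorph1 mul1r mulr1.
rewrite -(frame_unit F (coef_bal b)); apply: eq_bigr => i _.
by rewrite /coef mulr_sumr; apply: eq_bigr => p _; rewrite rmorphM !mulrA.
Qed.

Lemma coef_mull i a z : (forall x, h x * z = z * h x) ->
  coef i (h a * z) = alg_str B (f (frame_l F i a)) * z.
Proof.
move=> zC; rewrite -hf -frame_sandwich rmorph_sum mulr_suml.
by apply: eq_bigr => p _; rewrite !rmorphM -!mulrA zC.
Qed.

Lemma coef_hom i a : coef i (h a) = alg_str B (f (frame_l F i a)).
Proof. by rewrite -[h a]mulr1 coef_mull ?mulr1 // => x; rewrite mulr1 mul1r. Qed.

(** The matrix l_i(e_j) is idempotent and in general not the identity, as A need not be free;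
    families of coefficients are fixed by it. *)
Lemma coef_expand i b :
  coef i b = \sum_j alg_str B (f (frame_l F i (frame_e F j))) * coef j b.
Proof.
rewrite -[in LHS](coef_basis b) coef_sum; apply: eq_bigr => j _.
by rewrite coef_mull // => x; apply: coef_comm.
Qed.
End Coefficients.

Section Amalgam.
Variables (C D : comPzRingType) (A : algebra C) (F : frame A) (f : C -> D).
Variables (B1 B2 : algebra D) (h1 : {rmorphism A -> B1}) (h2 : {rmorphism A -> B2}).
Hypotheses (hf1 : forall c, h1 (alg_str A c) = alg_str B1 (f c))
  (hf2 : forall c, h2 (alg_str A c) = alg_str B2 (f c)).
Local Notation T := (tensor_algebra B1 B2).
Local Notation tp a b := (@apure D B1 B2 a b : T).

Definition amalgl (b : B1) : T := tp b 1.

Fact amalgl_additive : zmod_morphism amalgl.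
Proof. by move=> a b; apply: (addIr (amalgl b)); rewrite subrK -[LHS]apureDl subrK. Qed.
Fact amalgl_multiplicative : monoid_morphism amalgl.
Proof. by split=> // a b; rewrite [RHS]apureM mulr1. Qed.
HB.instance Definition _ := GRing.isZmodMorphism.Build B1 T amalgl amalgl_additive.
HB.instance Definition _ :=
  GRing.isMonoidMorphism.Build B1 T amalgl amalgl_multiplicative.

(* B2 is A ⊗ Z with Z the centralizer of A, and this is the embedding of
   A ⊗ Z into B1 ⊗ B2 as h1(A) ⊗ Z: it agrees with [amalgl] on A. *)
Definition amalgr (b : B2) : T := \sum_i tp (h1 (frame_e F i)) (coef h2 i b).

Lemma amalgrD a b : amalgr (a + b) = amalgr a + amalgr b.
Proof.
by rewrite /amalgr -big_split; apply: eq_bigr => i _; rewrite coefD apureDr.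
Qed.

Lemma amalgr0 : amalgr 0 = 0.
Proof. by rewrite /amalgr big1 // => i _; rewrite coef0 apure0r. Qed.

Lemma amalgr_sum (J : Type) (s : seq J) (G : J -> B2) :
  amalgr (\sum_(j <- s) G j) = \sum_(j <- s) amalgr (G j).
Proof. by apply: big_morph; [apply: amalgrD|apply: amalgr0]. Qed.

Lemma amalgrE a z : (forall x, h2 x * z = z * h2 x) ->
  amalgr (h2 a * z) = tp (h1 a) z.
Proof.
move=> zC; rewrite /amalgr -[in RHS](frame_basis F a) rmorph_sum.
rewrite (abalanced_suml (apure_bal _ _)); apply: eq_bigr => i _.
by rewrite (coef_mull hf2) // rmorphM hf1 -apureZ.
Qed.

Lemma amalgr_hom a : amalgr (h2 a) = amalgl (h1 a).
Proof. by rewrite -[h2 a]mulr1 amalgrE // => x; rewrite mulr1 mul1r. Qed.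

Lemma amalgr_center z : (forall x, h2 x * z = z * h2 x) -> amalgr z = tp 1 z.
Proof. by move=> zC; rewrite -[in LHS](mul1r z) -(rmorph1 h2) amalgrE // rmorph1. Qed.

Fact amalgr_additive : zmod_morphism amalgr.
Proof. by move=> a b; apply: (addIr (amalgr b)); rewrite subrK -amalgrD subrK. Qed.

(** After expanding both arguments, the coefficient a_i commutes past h2(e_j), so each term is
    h2(e_i e_j) (a_i b_j) with a_i b_j in the centralizer, where [amalgrE] applies. *)
Fact amalgr_multiplicative : monoid_morphism amalgr.
Proof.
split=> [|a b]; first by rewrite -(rmorph1 h2) amalgr_hom rmorph1 rmorph1.
have cC (i : frame_idx F) x y := coef_comm hf2 i x y.
rewrite -[a in LHS](coef_basis F hf2) -[b in LHS](coef_basis F hf2).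
rewrite mulr_suml amalgr_sum [RHS]mulr_suml; apply: eq_bigr => i _.
rewrite [_ * coef h2 i a * _]mulr_sumr amalgr_sum [RHS]mulr_sumr; apply: eq_bigr => j _.
rewrite [RHS]apureM -rmorphM -amalgrE.
  by rewrite rmorphM -!mulrA; congr (amalgr (_ * _)); rewrite mulrA -cC -mulrA.
by move=> x; rewrite mulrA cC -mulrA cC mulrA.
Qed.

Definition amalgr_rmorphism : {rmorphism B2 -> T} :=
  HB.pack amalgr (GRing.isZmodMorphism.Build B2 T amalgr amalgr_additive)
    (GRing.isMonoidMorphism.Build B2 T amalgr amalgr_multiplicative).

Variables (F1 : frame B1) (F2 : frame B2).

Lemma amalg_equalizer y1 y2 : amalgl y1 = amalgr y2 -> forall i,
  exists d, coef (F := F) h1 i y1 = alg_str B1 d /\ coef h2 i y2 = alg_str B2 d.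
Proof.
move=> y12 i.
have bal1 : abalanced (fun (a : B1) (b : B2) => @apure D B1 B2 (coef h1 i a) b).
  split=> [a a' b|a b b'|c a b].
  - by rewrite coefD apureDl.
  - by rewrite apureDr.
  - by rewrite coefZ apureZ.
(* [coef h1 i] is applied in the first factor. It turns h1(e_j) into the scalar l_i(e_j), which
   crosses the tensor sign and is absorbed by [coef_expand]. *)
have e1 : tp (coef h1 i y1) 1 = tp 1 (coef h2 i y2).
  have := congr1 (alift (fun a b => apure (coef h1 i a) b)) y12.
  rewrite (aliftE bal1) => ->.
  rewrite (alift_sum bal1) (coef_expand hf2) (abalanced_sumr (apure_bal _ _)).
  apply: eq_bigr => j _.
  by rewrite (aliftE bal1) (coef_hom hf1) -[alg_str B1 _]mulr1 apureZ.
(* Retracting the first factor onto D shows that the second coefficient is a scalar; retracting the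
   second factor, via [bal3], does the same for the first one. *)
have bal2 : abalanced (fun (a : B1) (b : B2) => alg_str B2 (frame_tr F1 a) * b).
  split=> [a a' b|a b b'|c a b].
  - by rewrite frame_trD rmorphD mulrDl.
  - by rewrite mulrDr.
  - by rewrite frame_trZ rmorphM mulrA -alg_strC.
have bal3 : abalanced (fun (a : B1) (b : B2) => alg_str B1 (frame_tr F2 b) * a).
  split=> [a a' b|a b b'|c a b].
  - by rewrite mulrDr.
  - by rewrite frame_trD rmorphD mulrDl.
  - by rewrite frame_trZ rmorphM -mulrA [RHS]alg_strC -!mulrA -[in RHS]alg_strC.
have := congr1 (alift (fun a b => alg_str B2 (frame_tr F1 a) * b)) e1.
rewrite !(aliftE bal2) mulr1 -[1](rmorph1 (alg_str B1)) frame_tr_str rmorph1 mul1r => e2.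
have := congr1 (alift (fun a b => alg_str B1 (frame_tr F2 b) * a)) e1.
rewrite !(aliftE bal3) mulr1 -[1](rmorph1 (alg_str B2)) frame_tr_str rmorph1 mul1r => e3.
exists (frame_tr F1 (coef h1 i y1)); split; last by [].
by rewrite {1}e3 -e2 frame_tr_str.
Qed.
End Amalgam.

Section BaseChangeCan.
Variables (C D : comPzRingType) (f : {rmorphism C -> D}) (A : algebra C).
Local Notation can := (@base_change_can C D f A).

Fact base_change_can_additive : zmod_morphism can.
Proof.
by move=> a b; apply: (addIr (can b)); rewrite subrK -[LHS]apureDl subrK.
Qed.
Fact base_change_can_multiplicative : monoid_morphism can.
Proof. by split=> // a b; rewrite [RHS]apureM mulr1. Qed.
HB.instance Definition _ := GRing.isZmodMorphism.Build A (base_change f A)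
  can base_change_can_additive.
HB.instance Definition _ := GRing.isMonoidMorphism.Build A (base_change f A)
  can base_change_can_multiplicative.

Lemma base_change_can_str c : can (alg_str A c) = alg_str (base_change f A) (f c).
Proof.
rewrite /base_change_can -[alg_str A c]mulr1 apureZ.
by rewrite /= /base_change_str mulr1.
Qed.

Lemma base_change_can_center : center_preserving can.
Proof.
move=> z Zz; elim/apure_ind => [|a d t IHt]; first by rewrite mul0r mulr0.
rewrite mulrDl mulrDr IHt; congr (_ + _).
by rewrite [LHS]apureM [RHS]apureM Zz mul1r mulr1.
Qed.
End BaseChangeCan.

Lemma amalgl_center (D : comPzRingType) (B1 B2 : algebra D) :
  center_preserving (amalgl B2 : B1 -> tensor_algebra B1 B2).
Proof.
move=> z Zz; elim/apure_ind => [|a d t IHt]; first by rewrite mul0r mulr0.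
rewrite mulrDl mulrDr IHt; congr (_ + _).
by rewrite [LHS]apureM [RHS]apureM Zz mul1r mulr1.
Qed.

Lemma amalgr_center_preserving (C D : comPzRingType) (A : algebra C)
    (F : frame A) (f : C -> D) (B1 B2 : algebra D)
    (h1 : {rmorphism A -> B1}) (h2 : {rmorphism A -> B2})
    (hf1 : forall c, h1 (alg_str A c) = alg_str B1 (f c))
    (hf2 : forall c, h2 (alg_str A c) = alg_str B2 (f c)) :
  center_preserving (amalgr_rmorphism F hf1 hf2).
Proof.
move=> z Zz; rewrite /= (amalgr_center F hf1 hf2); last first.
  by move=> x; rewrite Zz.
elim/apure_ind => [|a d t IHt]; first by rewrite mul0r mulr0.
rewrite mulrDl mulrDr IHt; congr (_ + _).
by rewrite [LHS]apureM [RHS]apureM Zz mul1r mulr1.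
Qed.

(** * Base rings, base changes and amalgams in the Azumaya category *)

Section AzumayaMorphisms.
Variable k : fieldType.
Local Notation "h @@ c" := (commalg_rmorphism h c) (at level 40).

Definition azu_rmorphism (A B : azumaya_cat k) (h : hom A B) :
  {rmorphism azu_alg A -> azu_alg B} := alghom_fun (azuhom_alghom h).

Definition lies_over (A B : azumaya_cat k) (h : hom A B)
    (f : @hom (commalg_cat k) (azu_base A) (azu_base B)) :=
  forall c, azu_rmorphism h (alg_str (azu_alg A) c) = alg_str (azu_alg B) (f @@ c).

(** h sends scalars into the center of B, which is its base ring by [frame_center]. The retraction
    reads off f, and injectivity of the structure map of B makes f a morphism. *)
Lemma azuhom_lies_over (A B : azumaya_cat k) (h : hom A B) :
  exists f, lies_over h f.
Proof.
have [FB] := azumaya_frame (azu_azumaya B).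
have strZ c : is_center (azu_rmorphism h (alg_str (azu_alg A) c)).
  apply: (@azuhom_center k A B h) => a; exact: (@alg_strC _ (azu_alg A)).
have trE c := frame_center FB (strZ c).
pose f c := frame_tr FB (azu_rmorphism h (alg_str (azu_alg A) c)).
have inj := frame_str_inj FB.
have fa : zmod_morphism f.
  by move=> a b; apply: inj; rewrite trE !rmorphB !trE.
have fm : monoid_morphism f.
  split=> [|a b]; apply: inj; first by rewrite trE !rmorph1.
  by rewrite trE !rmorphM !trE.
pose f' : {rmorphism azu_base A -> azu_base B} := HB.pack f
  (GRing.isZmodMorphism.Build _ _ f fa) (GRing.isMonoidMorphism.Build _ _ f fm).
have f'k c : f' (commalg_str (azu_base A) c) = commalg_str (azu_base B) c.
  by apply: inj; rewrite /= trE; exact: (alghom_str (azuhom_alghom h) c).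
exists (@Alghom k (commalg_alg (azu_base A)) (commalg_alg (azu_base B)) f' f'k).
by move=> c; rewrite -trE.
Qed.

Section AzumayaBaseChange.
Variables (B : azumaya_cat k) (E : commalg_cat k).
Variable g : @hom (commalg_cat k) (azu_base B) E.

Fact azu_base_change_subproof : azumaya (base_change (commalg_rmorphism g) (azu_alg B)).
Proof.
have [F] := azumaya_frame (azu_azumaya B).
exact: (frame_azumaya (base_change_frame _ F)).
Qed.

Definition azu_base_change : azumaya_cat k := Azu azu_base_change_subproof.

Definition azu_base_change_hom : hom B azu_base_change.
Proof.
unshelve refine (@Azuhom k B azu_base_change (@Alghom k (azu_kalg B)
  (azu_kalg azu_base_change)
  (@base_change_can _ _ (commalg_rmorphism g) (azu_alg B) : {rmorphism _ -> _}) _) _).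
- move=> c; apply: etrans (base_change_can_str _ _ _) _.
  by rewrite commalg_str_hom.
- exact: (@base_change_can_center _ _ (commalg_rmorphism g) (azu_alg B)).
Defined.

Lemma azu_base_change_lies_over : lies_over azu_base_change_hom g.
Proof. by move=> c; apply: base_change_can_str. Qed.
End AzumayaBaseChange.

Lemma lies_over_comp (A B D : azumaya_cat k) (h : hom A B) (h' : hom B D) f f' :
  lies_over h f -> lies_over h' f' -> lies_over (comp h' h) (comp f' f).
Proof. by move=> hf hf' c; rewrite -[LHS]/(azu_rmorphism h' (azu_rmorphism h _)) hf hf'. Qed.

Section AzumayaAmalgam.
Variables (A : azumaya_cat k) (F : frame (azu_alg A)) (D : commalg_cat k).
Variables (B1 B2 : algebra (commalg_sort D)) (az1 : azumaya B1) (az2 : azumaya B2).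
Variable f : @hom (commalg_cat k) (azu_base A) D.
Local Notation azu1 := (Azu az1 : azumaya_cat k).
Local Notation azu2 := (Azu az2 : azumaya_cat k).
Variables (h1 : hom A azu1) (h2 : hom A azu2).
Hypotheses (hf1 : lies_over h1 f) (hf2 : lies_over h2 f).

Fact azu_amalgam_subproof : azumaya (tensor_algebra B1 B2).
Proof.
have [F1] := azumaya_frame az1; have [F2] := azumaya_frame az2.
exact: (frame_azumaya (tensor_frame F1 F2)).
Qed.

Definition azu_amalgam : azumaya_cat k := Azu azu_amalgam_subproof.

Definition azu_amalgl : hom azu1 azu_amalgam.
Proof.
unshelve refine (@Azuhom k (Azu az1) azu_amalgam (@Alghom k (azu_kalg (Azu az1))
  (azu_kalg azu_amalgam) (@amalgl D B1 B2 : {rmorphism _ -> _}) _) _).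
- by [].
- exact: (@amalgl_center _ B1 B2).
Defined.

Definition azu_amalgr : hom azu2 azu_amalgam.
Proof.
unshelve refine (@Azuhom k (Azu az2) azu_amalgam (@Alghom k (azu_kalg (Azu az2))
  (azu_kalg azu_amalgam) (amalgr_rmorphism F hf1 hf2) _) _).
- move=> c; apply: etrans (amalgr_center F hf1 hf2 _) _.
    by move=> x; rewrite [in RHS]alg_strC.
  by rewrite /= /tensor_str -[alg_str B1 _]mulr1 -[alg_str B2 _]mulr1 apureZ.
- exact: (amalgr_center_preserving F hf1 hf2).
Defined.

Lemma azu_amalgam_comm : comp azu_amalgl h1 = comp azu_amalgr h2.
Proof.
by apply: azuhom_ext => a; apply/esym/(amalgr_hom F hf1 hf2).
Qed.
End AzumayaAmalgam.
End AzumayaMorphisms.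

(** * Gluing *)

Section Glue.
Variables (k : fieldType) (R : algebra k) (A : azumaya_cat k) (S : hom_family A).
Hypotheses (sS : is_sieve S) (topS : ring_topology (flat_shadow S)).
Variable x : forall (B : azumaya_cat k) (h : hom A B), S h -> Rep R B.
Hypothesis x_match : matching x.
Variable F : frame (azu_alg A).
Local Notation "h @@ c" := (commalg_rmorphism h c) (at level 40).
Local Notation T := (flat_shadow S).

Let val (B : azumaya_cat k) (h : hom A B) (Sh : S h) : {rmorphism R -> azu_alg B} :=
  alghom_fun (x Sh).

Fact val_irr (B : azumaya_cat k) (h h' : hom A B) (Sh : S h) (Sh' : S h') :
  h = h' -> val Sh = val Sh'.
Proof. by move=> e; subst h'; rewrite (Prop_irrelevance Sh Sh'). Qed.

Fact val_comp (B D : azumaya_cat k) (h : hom A B) (g : hom B D) (Sh : S h)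
    (Sgh : S (comp g h)) r : azu_rmorphism g (val Sh r) = val Sgh r.
Proof. exact: (congr1 (fun y : Rep R D => (y : alghom _ _) r) (x_match Sh Sgh)). Qed.

Fact val_str (B : azumaya_cat k) (h : hom A B) (Sh : S h) c :
  val Sh (alg_str R c) = alg_str (azu_alg B) (commalg_str (azu_base B) c).
Proof. exact: (alghom_str (x Sh : alghom _ _) c). Qed.

Fact val_compare (D : commalg_cat k) (f : @hom (commalg_cat k) (azu_base A) D)
    (B1 B2 : algebra (commalg_sort D)) (az1 : azumaya B1) (az2 : azumaya B2)
    (h1 : hom A (Azu az1 : azumaya_cat k)) (h2 : hom A (Azu az2 : azumaya_cat k))
    (Sh1 : S h1) (Sh2 : S h2) (hf1 : lies_over h1 f) (hf2 : lies_over h2 f)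
    (i : frame_idx F) r :
  exists d : commalg_sort D,
    coef (azu_rmorphism h1) i (val Sh1 r) = alg_str B1 d /\
    coef (azu_rmorphism h2) i (val Sh2 r) = alg_str B2 d.
Proof.
have [F1] := azumaya_frame az1; have [F2] := azumaya_frame az2.
apply: (amalg_equalizer hf1 hf2 F1 F2).
have S1 := sS (azu_amalgl az1 az2) Sh1.
have S2 := sS (azu_amalgr F hf1 hf2) Sh2.
have := val_irr S1 S2 (azu_amalgam_comm F hf1 hf2).
by move=> /(congr1 (fun v : {rmorphism _ -> _} => v r)); rewrite -!val_comp.
Qed.

Fact shadow_witness (D : commalg_cat k) (f : @hom (commalg_cat k) (azu_base A) D) :
  T f -> exists (B : algebra (commalg_sort D)) (az : azumaya B)
    (h : hom A (Azu az : azumaya_cat k)), S h /\ lies_over h f.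
Proof.
move=> [_ [B [az [g [h [_ Sh hg]]]]]]; exists B, az, h; split=> // c.
apply: etrans (hg _) _; rewrite base_change_can_str.
exact: (alghom_str g).
Qed.

Fact local_coef_ex (D : commalg_cat k) (f : @hom (commalg_cat k) (azu_base A) D)
    (i : frame_idx F) r :
  exists d : commalg_sort D, T f ->
    forall (B : algebra (commalg_sort D)) (az : azumaya B)
      (h : hom A (Azu az : azumaya_cat k)) (Sh : S h), lies_over h f ->
    coef (azu_rmorphism h) i (val Sh r) = alg_str B d.
Proof.
have [Tf|nTf] := pselect (T f); last by exists 0.
have [B0 [az0 [h0 [Sh0 hf0]]]] := shadow_witness Tf.
(* Comparing the reference witness with itself shows that its coefficient is a scalar; comparing it
   with any other h over f shows that the scalar is the same. *)
have [d [d0 _]] := val_compare Sh0 Sh0 hf0 hf0 i r.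
exists d => _ B az h Sh hf.
have [d' [d0' ->]] := val_compare Sh0 Sh hf0 hf i r.
have [F0] := azumaya_frame az0.
by congr (alg_str B _); apply: (frame_str_inj F0); rewrite -d0 -d0'.
Qed.

Let local_coef i r (D : commalg_cat k) (f : @hom (commalg_cat k) (azu_base A) D) :=
  projT1 (cid (local_coef_ex f i r)).

Fact local_coefP i r (D : commalg_cat k) (f : @hom (commalg_cat k) (azu_base A) D) :
  T f ->
  forall (B : algebra (commalg_sort D)) (az : azumaya B)
    (h : hom A (Azu az : azumaya_cat k)) (Sh : S h), lies_over h f ->
  coef (azu_rmorphism h) i (val Sh r) = alg_str B (local_coef i r f).
Proof. by rewrite /local_coef; case: cid. Qed.

Fact coef_base_change (B : azumaya_cat k) (h : hom A B) (E : commalg_cat k)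
    (g : @hom (commalg_cat k) (azu_base B) E) (i : frame_idx F) b :
  coef (azu_rmorphism (comp (azu_base_change_hom g) h)) i
    (azu_rmorphism (azu_base_change_hom g) b) =
  azu_rmorphism (azu_base_change_hom g) (coef (azu_rmorphism h) i b).
Proof.
rewrite /coef [RHS]rmorph_sum; apply: eq_bigr => p _.
by rewrite !rmorphM.
Qed.

(** The base change along g of a witness over f belongs to S and lies over the composite of f and g.
    Since any member of S over a shadow map computes the coefficient, this one may be used. *)
Fact local_coef_matching i r : ring_matching T (local_coef i r).
Proof.
move=> D E f g Tf; have [B [az [h [Sh hf]]]] := shadow_witness Tf.
have Tgf := topS.1 _ _ _ g Tf.
pose j := azu_base_change_hom (g : @hom (commalg_cat k) (azu_base (Azu az)) E).
have Sjh := sS j Sh.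
have jhf : lies_over (comp j h) (comp g f).
  by apply: lies_over_comp => //; apply: azu_base_change_lies_over.
have [FE] := azumaya_frame (azu_azumaya (azu_base_change
  (g : @hom (commalg_cat k) (azu_base (Azu az)) E))).
apply: (frame_str_inj FE); rewrite -(local_coefP i r Tgf Sjh jhf) -val_comp.
rewrite coef_base_change (local_coefP i r Tf Sh hf).
by rewrite azu_base_change_lies_over.
Qed.

Fact glue_coef_ex i r : exists c : azu_base A,
  forall (D : commalg_cat k) (f : @hom (commalg_cat k) (azu_base A) D), T f ->
  f @@ c = local_coef i r f.
Proof. exact: ((ring_topology_eff topS).1 _ (local_coef_matching i r)). Qed.

Let glue_coef i r := projT1 (cid (glue_coef_ex i r)).

Fact glue_coefP i r (D : commalg_cat k) (f : @hom (commalg_cat k) (azu_base A) D) :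
  T f -> f @@ glue_coef i r = local_coef i r f.
Proof. exact: (projT2 (cid (glue_coef_ex i r)) D f). Qed.

Let glue (r : R) : azu_alg A :=
  \sum_i alg_str (azu_alg A) (glue_coef i r) * frame_e F i.

Fact glue_local (D : commalg_cat k) (f : @hom (commalg_cat k) (azu_base A) D)
    (B : algebra (commalg_sort D)) (az : azumaya B)
    (h : hom A (Azu az : azumaya_cat k)) (Sh : S h) r : T f -> lies_over h f ->
  azu_rmorphism h (glue r) = val Sh r.
Proof.
move=> Tf hf; rewrite rmorph_sum -[RHS](coef_basis F hf); apply: eq_bigr => i _.
by rewrite rmorphM hf glue_coefP // (local_coefP i r Tf Sh hf) -alg_strC.
Qed.

(** The coordinates l_i(a) are elements of C, which the shadow separates, and [coef_hom] reads
    f(l_i(a)) off h(a). All identities for [glue], as well as uniqueness, reduce to local ones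
    through this. *)
Fact shadow_separated a a' :
  (forall (D : commalg_cat k) (f : @hom (commalg_cat k) (azu_base A) D)
    (B : algebra (commalg_sort D)) (az : azumaya B)
    (h : hom A (Azu az : azumaya_cat k)), S h -> T f -> lies_over h f ->
    azu_rmorphism h a = azu_rmorphism h a') -> a = a'.
Proof.
move=> aa'; rewrite -(frame_basis F a) -(frame_basis F a'); apply: eq_bigr => i _.
congr (alg_str _ _ * _); apply: (ring_topology_eff topS).2 => D f Tf.
have [B [az [h [Sh hf]]]] := shadow_witness Tf.
have [FB] := azumaya_frame az.
apply: (frame_str_inj FB); have := coef_hom hf i a; rewrite (aa' D f) //.
by move=> <-; rewrite (coef_hom hf).
Qed.

Fact glue_additive : zmod_morphism glue.
Proof.
move=> r r'; apply: shadow_separated => D f B az h Sh Tf hf.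
by rewrite rmorphB !(glue_local Sh _ Tf hf) rmorphB.
Qed.

Fact glue_multiplicative : monoid_morphism glue.
Proof.
split=> [|r r']; apply: shadow_separated => D f B az h Sh Tf hf.
  by rewrite (glue_local Sh _ Tf hf) !rmorph1.
by rewrite rmorphM !(glue_local Sh _ Tf hf) rmorphM.
Qed.

Let glue_rmorphism : {rmorphism R -> azu_alg A} :=
  HB.pack glue (GRing.isZmodMorphism.Build _ _ glue glue_additive)
    (GRing.isMonoidMorphism.Build _ _ glue glue_multiplicative).

Fact glue_str c : glue_rmorphism (alg_str R c) = alg_str (azu_kalg A) c.
Proof.
apply: shadow_separated => D f B az h Sh Tf hf.
rewrite [LHS](glue_local Sh _ Tf hf) val_str.
by rewrite -[in RHS]/(azu_rmorphism h _) /= hf commalg_str_hom.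
Qed.

(** Here f need not be in the shadow. For g in the pullback of the shadow along f, the base change
    of B along g is the target of a member of S over a shadow map, so [glue_local] applies there;
    the pullback covers, hence separates the coordinates in the center of B. *)
Fact glue_global (B : azumaya_cat k) (h : hom A B) (Sh : S h) r :
  azu_rmorphism h (glue r) = val Sh r.
Proof.
have [f hf] := azuhom_lies_over h.
have [FB] := azumaya_frame (azu_azumaya B).
rewrite -[LHS](frame_basis FB) -[RHS](frame_basis FB); apply: eq_bigr => j _.
congr (alg_str _ _ * _).
apply: (ring_topology_eff (ring_topology_pull f topS)).2 => E g Tgf.
pose u := azu_base_change_hom (g : @hom (commalg_cat k) (azu_base B) E).
have Suh := sS u Sh.
have uhf : lies_over (comp u h) (comp g f).
  by apply: lies_over_comp => //; apply: azu_base_change_lies_over.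
have := glue_local Suh r Tgf uhf; rewrite -val_comp.
move=> /(congr1 (base_change_l (f := commalg_rmorphism g) (F := FB) j)).
by rewrite !base_change_lE !mulr1.
Qed.

Lemma rep_glue : exists! s : Rep R A, forall (B : azumaya_cat k) (h : hom A B)
  (Sh : S h), cop_map (Rep R) h s = x Sh.
Proof.
exists (@Alghom k R (azu_kalg A) glue_rmorphism glue_str); split=> [B h Sh|s sP].
  by apply: alghom_ext => r; apply: (glue_global Sh).
apply: alghom_ext => r; apply: shadow_separated => D f B az h Sh Tf hf.
rewrite [LHS](glue_local Sh r Tf hf).
by rewrite /val -(sP _ h Sh).
Qed.
End Glue.

Theorem theorem5p1 (K : realType) (R : algebra K[i]) (fgR : fg_algebra R)
    (J : covering (azumaya_cat K[i])) (topJ : grothendieck_topology J)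
    (coarseJ : coarser J (@max_flat_topology K[i])) :
  is_sheaf J (Rep R).
Proof.
move=> A S JS x x_match.
have [sS /flat_topology_ring_topology topS] := coarseJ _ _ JS.
have [F] := azumaya_frame (azu_azumaya A).
exact: (rep_glue sS topS x_match F).
Qed.
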